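(* Let $E$ be a countable set and let $(M_i : i\in\Theta)$ be a family of matroids on the common ground set $E$ such that every $M_i$ belongs to $\mathfrak F\oplus\mathfrak F^{*}$. Then there is a partition $E=E_p\sqcup E_c$ such that the family $(M_i\upharpoonright E_p : i\in\Theta)$ admits a packing and the family $(M_i . E_c : i\in\Theta)$ admits a covering.
   Context: Matroids are possibly infinite: a matroid is a pair $M=(E,\mathcal I)$ with $\mathcal I\subseteq\mathcal P(E)$ such that (1) $\varnothing\in\mathcal I$; (2) $\mathcal I$ is closed under subsets; (3) for all $I,J\in\mathcal I$ with $J$ maximal in $\mathcal I$ and $I$ not maximal, there is $e\in J\setminus I$ with $I\cup\{e\}\in\mathcal I$; (4) for every $X\subseteq E$, every $I\in\mathcal I$ with $I\subseteq X$ extends to a maximal element of $\{J\in\mathcal I: J\subseteq X\}$. Bases are maximal independent sets, circuits are minimal dependent sets. The dual $M^*$ has as bases the complements of bases of $M$. $M\upharpoonright X$ is the restriction to $X$, $M/X:=(M^*\upharpoonright(E\setminus X))^*$ is contraction, and $M.X:=M/(E\setminus X)$ (a matroid on $X$). $\mathsf{span}_M(X)$ consists of the elements of $X$ together with those $e$ for which there is a circuit $C\ni e$ with $C\setminus\{e\}\subseteq X$; $S$ is spanning if $\mathsf{span}_M(S)=E$. A matroid is finitary if all its circuits are finite, cofinitary if its dual is finitary; $\mathfrak F\oplus\mathfrak F^*$ is the class of matroids that are a direct sum of a finitary and a cofinitary matroid (equivalently, each connected component of the circuit hypergraph is finitary or cofinitary). For a family $(K_i:i\in\Theta)$ of matroids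 on a common set $F$: a packing is a family $(S_i:i\in\Theta)$ of pairwise disjoint subsets of $F$ with $S_i$ spanning in $K_i$; a covering is a family $(I_i:i\in\Theta)$ with $I_i$ independent in $K_i$ and $\bigcup_i I_i=F$. *)

(* Defs.v *)
From Stdlib Require Import List.

Section Matroids.
Context {T : Type}.

Definition set := T -> Prop.
Definition subset (A B : set) : Prop := forall x, A x -> B x.
Definition setI (A B : set) : set := fun x => A x /\ B x.
Definition setU (A B : set) : set := fun x => A x \/ B x.
Definition setD (A B : set) : set := fun x => A x /\ ~ B x.
Definition set1 (e : T) : set := fun x => x = e.
Definition set0 : set := fun _ => False.
Definition finite_set (A : set) : Prop :=
  exists l : list T, forall x, A x -> In x l.
Definition countable_set (A : set) : Prop :=
  exists f : T -> nat, forall x y, A x -> A y -> f x = f y -> x = y.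

Record matroid := Matroid { ground : set ; indep : set -> Prop }.

Definition maximal_indep_in (M : matroid) (X J : set) : Prop :=
  indep M J /\ subset J X /\
  forall K, indep M K -> subset K X -> subset J K -> subset K J.

Definition is_base (M : matroid) (B : set) : Prop :=
  maximal_indep_in M (ground M) B.

Definition is_matroid (M : matroid) : Prop :=
  (forall I, indep M I -> subset I (ground M)) /\
  indep M set0 /\
  (forall I J, indep M I -> subset J I -> indep M J) /\
  (forall I J, indep M I -> is_base M J -> ~ is_base M I ->
     exists e, J e /\ ~ I e /\ indep M (setU I (set1 e))) /\
  (forall X I, subset X (ground M) -> indep M I -> subset I X ->
     exists J, maximal_indep_in M X J /\ subset I J).

Definition dual (M : matroid) : matroid :=
  Matroid (ground M)
    (fun I => exists B, is_base M B /\ subset I (setD (ground M) B)).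

Definition restr (M : matroid) (X : set) : matroid :=
  Matroid (setI X (ground M)) (fun I => indep M I /\ subset I X).

Definition contract (M : matroid) (X : set) : matroid :=
  dual (restr (dual M) (setD (ground M) X)).

Definition contr_to (M : matroid) (X : set) : matroid :=
  contract M (setD (ground M) X).

Definition is_circuit (M : matroid) (C : set) : Prop :=
  subset C (ground M) /\ ~ indep M C /\
  forall D, subset D C -> ~ indep M D -> subset C D.

Definition span (M : matroid) (X : set) : set :=
  fun e => X e \/
    exists C, is_circuit M C /\ C e /\ (forall y, C y -> y <> e -> X y).

Definition spanning (M : matroid) (S : set) : Prop :=
  forall e, span M S e <-> ground M e.

Definition finitary (M : matroid) : Prop :=
  forall C, is_circuit M C -> finite_set C.
Definition cofinitary (M : matroid) : Prop := finitary (dual M).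

Definition in_F_plus_Fstar (M : matroid) : Prop :=
  exists A B : set,
    (forall x, ground M x <-> A x \/ B x) /\ (forall x, ~ (A x /\ B x)) /\
    (forall I, indep M I <->
       subset I (ground M) /\ indep (restr M A) (setI I A) /\
       indep (restr M B) (setI I B)) /\
    finitary (restr M A) /\ cofinitary (restr M B).

Definition has_packing {Θ : Type} (K : Θ -> matroid) (F : set) : Prop :=
  exists S : Θ -> set,
    (forall i, subset (S i) F) /\
    (forall i j x, i <> j -> S i x -> S j x -> False) /\
    (forall i, spanning (K i) (S i)).

Definition has_covering {Θ : Type} (K : Θ -> matroid) (F : set) : Prop :=
  exists I : Θ -> set,
    (forall i, indep (K i) (I i)) /\
    (forall x, F x <-> exists i, I i x).

End Matroids.

(* Main.v *)
From Stdlib Require Import List Classical ClassicalEpsilon Arith Lia.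
Require Import Defs.

(** Let W be the largest set such that the restrictions of the matroids to W admit a packing;
    it exists because packings of an increasing sequence of sets can be composed. In the
    contractions K_i by W, only the empty set admits a packing, and the rest E0 has to be covered
    by sets independent in the K_i.

    A state records for every element e of E0 the set of indices i still allowed for e; for the
    other indices e is treated as a loop. A state is exact if every packing of a set X uses
    all elements of X; the initial state is. Elements are committed one by one to a single
    index, keeping exactness (replacing the unused element of a packing along circuits shows
    which indices can be chosen). If C is a circuit committed to a finitary K_i, then C minus a
    point is a packing of C with an unused element, so finitary K_i cause no problem in the limit.
    In a cofinitary K_i the set I_i obtained in the limit is independent if for each e in I_i
    at some stage e is certified, i.e. not spanned by the other elements still allowed for i.

    Certifying a committed element h is the key step. Suppose that it is impossible. Consider all
    states reachable by commitments and by moves of committed elements to other indices which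
    preserve exactness and certificates. Run through E0, committing elements, certifying
    whatever can be certified, and committing the largest packing. Elements which can
    never move again are called dead; h is dead, and so is each element that can never be
    certified. If e is dead and spanned in K_j by a circuit, then the committed members of
    that circuit are dead too (in the cofinitary case, those which are certified), for if one
    of them moved away then e could take its place. In the limit the dead elements, with the
    indices they are committed to, therefore form a packing of their union, in the cofinitary
    case because a failure would be witnessed by a finite cocircuit at a finite stage. As h
    is spanned by the other dead elements, it can be dropped from that packing, which
    contradicts exactness. *)

Ltac sets :=
  unfold subset, setU, setI, setD, set1, set0 in *; intuition (subst; eauto).

Definition rem {T} (X : @set T) (z : T) : set := setD X (set1 z).
Definition add {T} (X : @set T) (z : T) : set := setU X (set1 z).

(** * Closure operators of infinite matroids *)

Section MatroidClosure.
Context {T : Type} (M : @matroid T) (HM : is_matroid M).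

(** Phrased with independent sets instead of circuits. A point outside the ground set lies in every
    closure, with the empty set as witness [I]. *)
Definition cl (X : set) : set :=
  fun e => X e \/ exists I, indep M I /\ subset I X /\ ~ indep M (add I e).

Lemma indep_ground I : indep M I -> subset I (ground M).
Proof. apply HM. Qed.

Lemma indep_sub I J : indep M I -> subset J I -> indep M J.
Proof. apply HM. Qed.

Lemma extend_maximal X I : indep M I -> subset I X ->
  exists J, maximal_indep_in M X J /\ subset I J.
Proof.
  intros HI HX.
  destruct HM as (Hg & _ & _ & _ & IM).
  destruct (IM (setI X (ground M)) I) as (J & (HJ & HJX & Hmax) & HIJ).
  - sets.
  - exact HI.
  - intros x Hx; split; [auto | exact (Hg I HI x Hx)].
  - exists J; split; [split; [exact HJ | split] | exact HIJ].
    + intros x Hx; apply (HJX x Hx).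
    + intros K HK HKX; apply Hmax; [exact HK |].
      intros x Hx; split; [auto | exact (Hg K HK x Hx)].
Qed.

Lemma maximal_exists X : exists J, maximal_indep_in M X J.
Proof.
  destruct (extend_maximal X set0) as (J & HJ & _); [apply HM | sets | eauto].
Qed.

Lemma not_maximal X I : indep M I -> subset I X -> ~ maximal_indep_in M X I ->
  exists x, X x /\ ~ I x /\ indep M (add I x).
Proof.
  intros HI HIX Hn. apply NNPP; intro Hno. apply Hn. split; [exact HI | split; [exact HIX |]].
  intros K HK HKX HIK x Hx. apply NNPP; intro Hx'. apply Hno. exists x.
  repeat split; auto. apply (indep_sub K); auto.
  intros y [Hy | Hy]; [auto | unfold set1 in Hy; subst; auto].
Qed.

Lemma maximal_add X B e : maximal_indep_in M X B -> X e -> indep M (add B e) -> B e.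
Proof.
  intros (HB & HBX & Hmax) He Hi.
  apply (Hmax (add B e)); auto.
  - intros y [Hy | Hy]; [auto | unfold set1 in Hy; subst; auto].
  - intros y Hy; left; exact Hy.
  - right; reflexivity.
Qed.

Lemma maximal_above_base B Y J : is_base M B -> subset B Y ->
  maximal_indep_in M Y J -> is_base M J.
Proof.
  intros HB HBY HJ. apply NNPP; intro Hn.
  destruct HM as (_ & _ & _ & I3 & _).
  destruct (I3 J B) as (e & He & Hne & Hi); [apply HJ | auto | auto |].
  apply Hne, (maximal_add Y J); auto.
Qed.

(** The exchange axiom compares only with bases of [M], so [B] and [I] are extended to bases. If no
    [e] exists, the new base [K], obtained by inserting [x] into a base [J] above [I], loses a point
    [d] outside [X]. Then [B] with the part of [K] outside [X] is not a base, and exchange with [K]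
    would enlarge [B] inside [X]. *)
Lemma augment_in X B I :
  maximal_indep_in M X B -> indep M I -> subset I X -> ~ maximal_indep_in M X I ->
  exists e, B e /\ ~ I e /\ indep M (add I e).
Proof.
  intros HBm HI HIX Hn.
  apply NNPP; intro Hno.
  destruct (not_maximal X I HI HIX Hn) as (x & HxX & HxI & HIx).
  destruct (extend_maximal (ground M) B) as (B' & HB' & HBB');
    [apply HBm | intros y Hy; exact (indep_ground B (proj1 HBm) y Hy) |].
  assert (HB'X : forall y, B' y -> X y -> B y).
  { intros y Hy HyX. apply (maximal_add X B); auto. apply (indep_sub B'); [apply HB' |].
    intros w [Hw | Hw]; [auto | unfold set1 in Hw; subst; auto]. }
  destruct (extend_maximal (setU I B') I) as (J & HJ & HIJ); [auto | sets |].
  assert (HJb : is_base M J).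
  { apply (maximal_above_base B' (setU I B')); auto; sets. }
  assert (HJI : forall y, J y -> X y -> I y).
  { intros y Hy HyX. apply NNPP; intro HyI. apply Hno. exists y.
    assert (Hy' := proj1 (proj2 HJ) y Hy). destruct Hy' as [Hy' | Hy']; [tauto |].
    repeat split; auto. apply (indep_sub J); [apply HJ |].
    intros w [Hw | Hw]; [auto | unfold set1 in Hw; subst; auto]. }
  destruct (extend_maximal (add J x) (add I x)) as (K & HK & HIK); [auto | |].
  { intros y [Hy | Hy]; [left | right]; auto. }
  assert (HKb : is_base M K).
  { apply (maximal_above_base J (add J x)); auto. intros y Hy; left; exact Hy. }
  assert (HJx : ~ J x) by (intro H; apply HxI; auto).
  assert (Hd : exists d, J d /\ ~ K d).
  { apply NNPP; intro Hno2. apply HJx. apply (proj2 (proj2 HJb) K).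
    - apply HK.
    - apply HKb.
    - intros y Hy; apply NNPP; intro; apply Hno2; exists y; auto.
    - apply HIK; right; reflexivity. }
  destruct Hd as (d & HdJ & HdK).
  assert (HdX : ~ X d).
  { intro HdX; apply HdK, HIK; left; auto. }
  assert (HdB' : B' d).
  { destruct (proj1 (proj2 HJ) d HdJ) as [H | H]; [exfalso; auto | auto]. }
  assert (HKB' : forall y, K y -> ~ X y -> B' y).
  { intros y Hy HyX. destruct (proj1 (proj2 HK) y Hy) as [H | H].
    - destruct (proj1 (proj2 HJ) y H) as [H1 | H1]; [exfalso; auto | auto].
    - unfold set1 in H; subst; tauto. }
  destruct HM as (_ & _ & _ & I3 & _).
  set (L := fun y => B y \/ (K y /\ ~ X y)).
  assert (HLB' : subset L B') by (intros y [Hy | [Hy HyX]]; auto).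
  destruct (I3 L K) as (e & HeK & HeL & Hi).
  - apply (indep_sub B'); [apply HB' | auto].
  - exact HKb.
  - intro HL. assert (L d) as [H | [H _]]; [| exact (HdX (proj1 (proj2 HBm) d H)) | auto].
    apply (proj2 (proj2 HL) B'); auto; apply HB'.
  - apply HeL. left. apply (maximal_add X B); auto.
    + apply NNPP; intro H; apply HeL; right; auto.
    + apply (indep_sub _ _ Hi). intros y [Hy | Hy]; [left; left | right]; auto.
Qed.

Lemma cl_ext X : subset X (cl X).
Proof. intros x Hx; left; exact Hx. Qed.

Lemma cl_mono X Y : subset X Y -> subset (cl X) (cl Y).
Proof.
  intros H x [Hx | (I & HI & HIX & Hd)]; [left; auto | right; exists I; sets].
Qed.

Lemma cl_indep B e : cl B e -> ~ B e -> ~ indep M (add B e).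
Proof.
  intros [H | (I & HI & HIB & Hd)] Hn; [tauto |]. intro Hi. apply Hd.
  apply (indep_sub _ _ Hi). intros y [Hy | Hy]; [left | right]; auto.
Qed.

Lemma dep_cl B e : indep M B -> ~ indep M (add B e) -> cl B e.
Proof. intros HB Hd; right; exists B; repeat split; auto; intros y Hy; exact Hy. Qed.

Lemma not_cl_indep B e : indep M B -> ~ cl B e -> indep M (add B e).
Proof. intros HB Hn; apply NNPP; intro H; apply Hn, dep_cl; auto. Qed.

(** A maximal independent [I'] of [X] above the witness [I] stays maximal in [X] plus [e], whereas
    [B] does not; augmenting [B] from [I'] then contradicts the maximality of [B] in [X]. *)
Lemma cl_maximal X B : maximal_indep_in M X B -> subset (cl X) (cl B).
Proof.
  intros HB e He. apply NNPP; intro Hn.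
  assert (HBi : indep M (add B e)) by (apply not_cl_indep; [apply HB | auto]).
  assert (HeB : ~ B e) by (intro; apply Hn; left; auto).
  destruct He as [He | (I & HI & HIX & Hd)].
  { apply HeB, (maximal_add X B); auto. }
  destruct (classic (X e)) as [HeX | HeX]; [apply HeB, (maximal_add X B); auto |].
  destruct (extend_maximal X I HI HIX) as (I' & HI' & HII').
  assert (Hd' : ~ indep M (add I' e)).
  { intro Hi; apply Hd, (indep_sub _ _ Hi). intros y [Hy | Hy]; [left | right]; auto. }
  assert (Hm : maximal_indep_in M (add X e) I').
  { split; [apply HI' | split].
    - intros y Hy; left; apply HI'; auto.
    - intros K HK HKX HIK. apply HI'; auto.
      intros y Hy. destruct (HKX y Hy) as [H | H]; auto.
      unfold set1 in H; subst. exfalso; apply Hd', (indep_sub _ _ HK).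
      intros w [Hw | Hw]; [auto | unfold set1 in Hw; subst; auto]. }
  destruct (augment_in (add X e) I' B) as (g & Hg & HgB & Hgi); auto.
  - apply HB.
  - intros y Hy; left; apply HB; auto.
  - intro HBm. apply HeB, (maximal_add (add X e) B); auto. right; reflexivity.
  - apply HgB, (maximal_add X B); auto. apply HI'; auto.
Qed.

Lemma cl_idem X : subset (cl (cl X)) (cl X).
Proof.
  destruct (maximal_exists X) as (B & HB).
  assert (HBX : subset B X) by apply HB.
  assert (HBm : maximal_indep_in M (cl X) B).
  { split; [apply HB | split].
    - intros y Hy; left; auto.
    - intros K HK HKX HBK y Hy. apply NNPP; intro Hn.
      apply (cl_indep B y); auto.
      + apply (cl_maximal X); auto.
      + apply (indep_sub K); auto. intros w [Hw | Hw]; [auto | unfold set1 in Hw; subst; auto]. }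
  intros e He. apply (cl_mono B); auto. apply (cl_maximal (cl X)); auto.
Qed.

Lemma cl_trans X Y : subset X (cl Y) -> subset (cl X) (cl Y).
Proof. intros H x Hx; apply cl_idem; exact (cl_mono _ _ H x Hx). Qed.

Lemma maximal_add_outside X B x : maximal_indep_in M X B -> ~ cl X x ->
  maximal_indep_in M (add X x) (add B x).
Proof.
  intros HB Hx. assert (HBX : subset B X) by apply HB.
  split; [| split].
  - apply not_cl_indep; [apply HB |]. intro H; apply Hx, (cl_mono B); auto.
  - intros y [Hy | Hy]; [left | right]; auto.
  - intros K HK HKX HBK y Hy.
    destruct (HKX y Hy) as [H | H]; [left | right; auto].
    apply (maximal_add X B); auto. apply (indep_sub K); auto.
    intros w [Hw | Hw]; [apply HBK; left; auto | unfold set1 in Hw; subst; auto].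
Qed.

Lemma cl_exch X x y : cl (add X x) y -> ~ cl X y -> cl (add X y) x.
Proof.
  intros Hy Hn. apply NNPP; intro Hx.
  destruct (maximal_exists X) as (B & HB).
  assert (HxX : ~ cl X x).
  { intro H; apply Hx. apply (cl_mono X); auto. intros w Hw; left; auto. }
  assert (H1 := maximal_add_outside X B y HB Hn).
  assert (H2 := maximal_add_outside (add X y) (add B y) x H1 Hx).
  assert (H3 := maximal_add_outside X B x HB HxX).
  assert (H4 := cl_maximal _ _ H3 y Hy).
  apply (cl_indep (add B x) y); auto.
  - intros [H | H]; [apply Hn; left; apply HB; auto |].
    unfold set1 in H; subst. apply Hx; left; right; reflexivity.
  - apply (indep_sub _ _ (proj1 H2)).
    intros w [[Hw | Hw] | Hw]; [left; left | right | left; right]; auto.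
Qed.

(** The fundamental circuit of [e] over [B], without [e] itself. *)
Definition fund (B : set) (e : T) : set := fun z => B z /\ indep M (add (rem B z) e).

(** Otherwise a maximal independent subset [K] of [B] plus [e] above this set omits some [z] of [B].
    Augmenting [B] minus [z] from [K] can only add [e], which puts [z] into [fund B e] and so into
    [K]. *)
Lemma fund_dep B e : indep M B -> ~ indep M (add B e) -> ~ indep M (add (fund B e) e).
Proof.
  intros HB Hd Hi.
  destruct (extend_maximal (add B e) (add (fund B e) e)) as (K & HK & HFK); auto.
  { intros y [[Hy _] | Hy]; [left | right]; auto. }
  assert (HKe : K e) by (apply HFK; right; reflexivity).
  assert (Hz : exists z, B z /\ ~ K z).
  { apply NNPP; intro Hno. apply Hd, (indep_sub K); [apply HK |].
    intros y [Hy | Hy]; [apply NNPP; intro; apply Hno; exists y; auto |].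
    unfold set1 in Hy; subst; auto. }
  destruct Hz as (z & HzB & HzK).
  destruct (augment_in (add B e) K (rem B z)) as (g & HgK & HgB & Hgi); auto.
  - apply (indep_sub B); auto. intros y [Hy _]; auto.
  - intros y [Hy _]; left; auto.
  - intros Hm. assert (H : rem B z z) by
      (apply (proj2 (proj2 Hm) B); auto; [intros y Hy; left; auto | intros y [Hy _]; auto]).
    destruct H as [_ H]; apply H; reflexivity.
  - assert (Hg : g = e).
    { destruct (proj1 (proj2 HK) g HgK) as [H | H]; [| exact H].
      exfalso; apply HgB; split; auto. intro H'; unfold set1 in H'; subst; auto. }
    subst. apply HzK, HFK. left; split; auto.
Qed.

Lemma fund_circuit B e : indep M B -> ground M e -> ~ indep M (add B e) ->
  is_circuit M (add (fund B e) e).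
Proof.
  intros HB He Hd. split; [| split].
  - intros y [[Hy _] | Hy]; [exact (indep_ground B HB y Hy) | unfold set1 in Hy; subst; auto].
  - apply fund_dep; auto.
  - intros D HDC HD y Hy. apply NNPP; intro Hn. apply HD.
    destruct Hy as [[Hy Hyi] | Hy].
    + apply (indep_sub _ _ Hyi). intros w Hw.
      assert (Hwy : w <> y) by (intro; subst; auto).
      destruct (HDC w Hw) as [[Hw' _] | Hw']; [left; split; auto | right; auto].
    + unfold set1 in Hy; subst. apply (indep_sub B); auto.
      intros w Hw. destruct (HDC w Hw) as [[Hw' _] | Hw']; auto.
      unfold set1 in Hw'; subst; tauto.
Qed.

(** A circuit through [e] in the contraction by [W]: extend a maximal independent subset of [W] to
    one of [S] and [W] together, and keep the part of the fundamental circuit outside [W]. *)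
Lemma cl_circ W S e : cl (setU S W) e -> ~ S e ->
  exists C, subset C S /\ cl (setU C W) e /\ forall z, C z -> ~ cl (setU (rem C z) W) e.
Proof.
  intros He HeS. destruct (classic (cl W e)) as [HW | HW].
  { exists set0. split; [sets |]. split; [| intros z []].
    apply (cl_mono W); auto; intros y Hy; right; auto. }
  assert (HeW : ~ W e) by (intro; apply HW; left; auto).
  destruct (maximal_exists W) as (BW & HBW).
  destruct (extend_maximal (setU S W) BW) as (B & HB & HBB); [apply HBW | |].
  { intros y Hy; right; apply HBW; auto. }
  assert (HBX : subset B (setU S W)) by apply HB.
  assert (HBi : indep M B) by apply HB.
  assert (HeB : ~ B e) by (intro H; destruct (HBX e H); auto).
  assert (Hd : ~ indep M (add B e)).
  { apply cl_indep; auto. apply (cl_maximal (setU S W)); auto. }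
  exists (fun z => fund B e z /\ ~ W z). split; [| split].
  - intros z ((Hz & _) & HzW). destruct (HBX z Hz); tauto.
  - apply (cl_mono (fund B e)).
    + intros z Hz. destruct (classic (W z)); [right | left]; auto.
    + apply dep_cl; [| apply fund_dep; auto].
      apply (indep_sub B); auto. intros z [Hz _]; auto.
  - intros z ((Hz & Hzi) & HzW) Hc.
    assert (Hcl : cl (rem B z) e).
    { apply (cl_trans (setU (rem (fun z0 => fund B e z0 /\ ~ W z0) z) W)); auto.
      intros y [(((Hy & _) & _) & Hyz) | Hy]; [left; split; auto |].
      apply (cl_mono BW).
      - intros w Hw; split; auto. intro H; unfold set1 in H; subst. apply HzW, HBW; auto.
      - apply (cl_maximal W); auto. left; auto. }
    apply (cl_indep (rem B z) e); auto. intros [H _]; auto.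
Qed.

End MatroidClosure.
(* [co] is the cofinitary summand; the other summand is finitary. *)
Record closure_system {T : Type} (c : @set T -> @set T) (co : @set T) : Prop := {
  cs_mono : forall X Y, subset X Y -> subset (c X) (c Y);
  cs_ext : forall X, subset X (c X);
  cs_idem : forall X, subset (c (c X)) (c X);
  cs_exch : forall X x y, c (add X x) y -> ~ c X y -> c (add X y) x;
  cs_circ : forall S e, c S e -> ~ S e ->
    exists C, subset C S /\ c C e /\ forall z, C z -> ~ c (rem C z) e;
  cs_sum : forall X e, co e -> c X e -> c (setI X co) e;
  cs_fin : forall Y e, ~ co e -> c Y e -> exists C, finite_set C /\ subset C Y /\ c C e;
  cs_cofin : forall Y e, co e -> ~ c Y e ->
    exists L : list T, (forall x, In x L -> ~ Y x) /\
      forall Y', (forall x, In x L -> ~ Y' x) -> ~ c Y' e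
}.

(** * Closure in a direct sum of a finitary and a cofinitary matroid *)

Section DirectSum.
Context {T : Type} (M : @matroid T) (HM : is_matroid M) (A B : @set T).
Context (HAB : forall x, ground M x <-> A x \/ B x) (Hdisj : forall x, ~ (A x /\ B x)).
Context (Hsum : forall I, indep M I <->
  subset I (ground M) /\ indep (restr M A) (setI I A) /\ indep (restr M B) (setI I B)).
Context (HA : finitary (restr M A)) (HB : cofinitary (restr M B)).

Lemma dep_add_part P I e : (P = A \/ P = B) -> P e ->
  indep M I -> ~ indep M (add I e) -> ~ indep M (add (setI I P) e).
Proof.
  intros HP He HI Hd Hi. apply Hd, Hsum. split; [| split].
  - intros y [Hy | Hy]; [exact (indep_ground M HM I HI y Hy) |].
    unfold set1 in Hy; subst y. apply HAB. destruct HP; subst; auto.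
  - split; [| intros y [_ Hy]; auto]. destruct HP; subst.
    + apply (indep_sub M HM _ _ Hi). intros y [[Hy | Hy] HyA]; [left; split | right]; auto.
    + apply (indep_sub M HM I); auto. intros y [[Hy | Hy] HyA]; auto.
      unfold set1 in Hy; subst. exfalso; apply (Hdisj e); auto.
  - split; [| intros y [_ Hy]; auto]. destruct HP; subst.
    + apply (indep_sub M HM I); auto. intros y [[Hy | Hy] HyA]; auto.
      unfold set1 in Hy; subst. exfalso; apply (Hdisj e); auto.
    + apply (indep_sub M HM _ _ Hi). intros y [[Hy | Hy] HyA]; [left; split | right]; auto.
Qed.

Lemma cl_part P X e : (P = A \/ P = B) -> P e -> cl M X e -> cl M (setI X P) e.
Proof.
  intros HP He [H | (I & HI & HIX & Hd)]; [left; split; auto |].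
  right. exists (setI I P). split; [| split].
  - apply (indep_sub M HM I); auto. intros y [Hy _]; auto.
  - intros y [Hy Hy']; split; auto.
  - apply dep_add_part; auto.
Qed.

Lemma circuit_restr X C : is_circuit M C -> subset C X -> is_circuit (restr M X) C.
Proof.
  intros (HC & Hd & Hm) HCX. split; [| split].
  - intros y Hy; split; auto.
  - intros [H _]; auto.
  - intros D HD Hn. apply Hm; auto. intro H; apply Hn; split; auto.
    intros y Hy; auto.
Qed.

Lemma cl_finite Y e : ~ B e -> cl M Y e ->
  exists C, finite_set C /\ subset C Y /\ cl M C e.
Proof.
  intros He HY. destruct (classic (Y e)) as [HeY | HeY].
  { exists (set1 e). split; [exists (e :: nil); intros x Hx; left; symmetry; exact Hx |].
    split; [intros x Hx; unfold set1 in Hx; subst; auto | left; reflexivity]. }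
  destruct (classic (ground M e)) as [Hg | Hg].
  2:{ exists set0. split; [exists nil; intros x [] |]. split; [intros x [] |].
      right. exists set0. split; [apply HM | split; [intros x [] |]].
      intro H. apply Hg, (indep_ground M HM _ H). right; reflexivity. }
  assert (HAe : A e) by (apply HAB in Hg; tauto).
  destruct HY as [H | (I & HI & HIX & Hd)]; [tauto |].
  assert (HIA : indep M (setI I A)) by (apply (indep_sub M HM I); auto; intros y [Hy _]; auto).
  assert (HdA : ~ indep M (add (setI I A) e)) by (apply dep_add_part; auto).
  assert (Hc := fund_circuit M HM _ e HIA Hg HdA).
  assert (HF : finite_set (add (fund M (setI I A) e) e)).
  { apply HA, circuit_restr; auto. intros y [[[_ Hy] _] | Hy]; auto.
    unfold set1 in Hy; subst; auto. }
  exists (fund M (setI I A) e). split; [| split].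
  - destruct HF as (l & Hl). exists l. intros x Hx; apply Hl; left; auto.
  - intros y [[Hy _] _]; auto.
  - apply dep_cl; auto.
    + apply (indep_sub M HM I); auto. intros y [[Hy _] _]; auto.
    + apply Hc.
Qed.

Lemma maximal_restr_base X J : maximal_indep_in M X J -> is_base (restr M X) J.
Proof.
  intros (HJ & HJX & Hm). split; [split; auto | split].
  - intros y Hy; split; [auto | exact (indep_ground M HM J HJ y Hy)].
  - intros K [HK HKX] _ HJK; auto.
Qed.

Lemma restr_base_maximal X J : is_base (restr M X) J -> maximal_indep_in M X J.
Proof.
  intros ((HJ & HJX) & HJg & Hm). split; [auto | split; [auto |]].
  intros K HK HKX HJK. apply Hm; auto.
  - split; auto.
  - intros y Hy; split; [auto | exact (indep_ground M HM K HK y Hy)].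
Qed.

(** The list is a cocircuit. A base of the summand [B] contains [e], and its other elements span the
    part of [Y] in [B]; what they fail to span in [B] is a circuit of the dual, hence finite. *)
Lemma cl_cofinite Y e : B e -> ~ cl M Y e ->
  exists L : list T, (forall x, In x L -> ~ Y x) /\
    forall Y', (forall x, In x L -> ~ Y' x) -> ~ cl M Y' e.
Proof.
  intros He HY.
  assert (HBg : forall x, B x -> ground M x) by (intros x Hx; apply HAB; auto).
  destruct (maximal_exists M HM (setI Y B)) as (BZ & HBZ).
  assert (HBZi : indep M (add BZ e)).
  { apply not_cl_indep; auto; [apply HBZ |]. intro H; apply HY.
    apply (cl_mono M BZ); auto. intros y Hy. apply (proj1 (proj2 HBZ) y Hy). }
  destruct (extend_maximal M HM B (add BZ e)) as (B1 & HB1 & HBZ1); auto.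
  { intros y [Hy | Hy]; [apply (proj1 (proj2 HBZ) y Hy) | unfold set1 in Hy; subst; auto]. }
  set (H1 := rem B1 e).
  assert (HB1i : indep M B1) by apply HB1.
  assert (HH1 : indep M H1) by (apply (indep_sub M HM B1); auto; intros y [Hy _]; auto).
  assert (HeB1 : B1 e) by (apply HBZ1; right; reflexivity).
  assert (HeH : ~ cl M H1 e).
  { intro H. apply (cl_indep M HM H1 e); auto.
    - intros [_ H']; apply H'; reflexivity.
    - apply (indep_sub M HM B1); auto. intros y [[Hy _] | Hy]; auto. unfold set1 in Hy; subst; auto. }
  set (D := fun x => B x /\ ~ cl M H1 x).
  assert (HD : is_circuit (dual (restr M B)) D).
  { split; [| split].
    - intros x [Hx _]; split; auto.
    - intros (B2 & HB2 & HDB2). apply restr_base_maximal in HB2.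
      apply HeH, (cl_trans M HM B2).
      + intros y Hy. apply NNPP; intro Hn. assert (HyB : B y) by (apply (proj1 (proj2 HB2)); auto).
        destruct (HDB2 y) as [_ H]; [split |]; auto.
      + apply (cl_maximal M HM B); auto. left; auto.
    - intros D' HD' Hdep d Hd. apply NNPP; intro Hn. apply Hdep.
      (* By exchange of [d] and [e], [H1] plus any [d] of [D] is again a base, so a subset of [D]
         omitting [d] is independent in the dual. *)
      assert (Hmax : maximal_indep_in M B (add H1 d)).
      { destruct Hd as [HdB Hdc].
        assert (Hi : indep M (add H1 d)) by (apply not_cl_indep; auto).
        split; [auto | split].
        - intros y [[Hy _] | Hy]; [apply HB1; auto | unfold set1 in Hy; subst; auto].
        - intros K HK HKB HK1 k Hk. apply NNPP; intro Hkn.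
          assert (Hd1 : cl M (add H1 e) d).
          { apply (cl_mono M B1).
            - intros y Hy. destruct (classic (y = e)); [right | left; split]; auto.
            - apply (cl_maximal M HM B); auto. left; auto. }
          assert (He1 : cl M (add H1 d) e) by (apply cl_exch; auto).
          apply (cl_indep M HM (add H1 d) k); auto.
          + apply (cl_trans M HM B1).
            * intros y Hy. destruct (classic (y = e)); [subst; auto | left; left; split; auto].
            * apply (cl_maximal M HM B); auto. left; auto.
          + apply (indep_sub M HM K); auto. intros y [Hy | Hy]; auto.
            unfold set1 in Hy; subst; auto. }
      exists (add H1 d). split; [apply maximal_restr_base; auto |].
      intros x Hx. destruct (HD' x Hx) as [HxB Hxc]. split; [split; auto |].
      intros [Hx1 | Hx1]; [apply Hxc; left; auto | unfold set1 in Hx1; subst; auto]. }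
  destruct (HB D HD) as (l & Hl).
  (* The list is filtered down to [D] because no listed element may lie in [Y]. *)
  assert (Hl' : exists L, forall x, In x L <-> D x).
  { clear - Hl.
    assert (H : forall l : list T, exists L, forall x, In x L <-> In x l /\ D x).
    { induction l0 as [| a l0 (L & HL)].
      - exists nil. intros x; simpl; tauto.
      - destruct (classic (D a)).
        + exists (a :: L). intro x; simpl. rewrite HL. intuition; subst; auto.
        + exists L. intro x; simpl. rewrite HL. intuition; subst; tauto. }
    destruct (H l) as (L & HL). exists L. intro x. rewrite HL. split; [tauto | auto]. }
  destruct Hl' as (L & HL). exists L. split.
  - intros x Hx HxY. apply HL in Hx. destruct Hx as [HxB Hxc]. apply Hxc.
    apply (cl_mono M BZ).
    + intros y Hy. split; [apply HBZ1; left; auto |].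
      intro H; unfold set1 in H; subst y. apply HY. left. apply (proj1 (proj2 HBZ) e Hy).
    + apply (cl_maximal M HM (setI Y B)); auto. left; split; auto.
  - intros Y' HY' Hc. apply HeH. apply (cl_trans M HM (setI Y' B)).
    + intros y [Hy HyB]. apply NNPP; intro Hn. apply (HY' y); auto. apply HL; split; auto.
    + apply cl_part; auto.
Qed.

Lemma matroid_closure_system W :
  closure_system (fun X => cl M (setU X W)) B.
Proof.
  split.
  - intros X Y H. apply cl_mono. intros x [Hx | Hx]; [left | right]; auto.
  - intros X x Hx; left; left; auto.
  - intros X x Hx. apply (cl_trans M HM _ _) with (2 := Hx).
    intros y [Hy | Hy]; [auto | left; right; auto].
  - intros X x y Hy Hn.
    apply (cl_mono M (add (setU X W) y)); [intros w [[Hw | Hw] | Hw]; [left; left | right | left; right]; auto |].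
    apply cl_exch; auto.
    apply (cl_mono M (setU (add X x) W)); auto.
    intros w [[Hw | Hw] | Hw]; [left; left | right | left; right]; auto.
  - intros S e. apply cl_circ; auto.
  - intros X e He H. apply cl_part with (P := B) in H; auto.
    apply (cl_mono M (setI (setU X W) B)); auto.
    intros y [[Hy | Hy] HyB]; [left; split | right]; auto.
  - intros Y e He H. destruct (cl_finite _ e He H) as (C & (l & Hl) & HCY & HC).
    exists (setI C Y). split; [exists l; intros x [Hx _]; auto |].
    split; [intros x [_ Hx]; auto |].
    apply (cl_mono M C); auto. intros x Hx. destruct (HCY x Hx); [left; split | right]; auto.
  - intros Y e He H. destruct (cl_cofinite _ e He H) as (L & HL & HL').
    exists L. split; [intros x Hx HxY; apply (HL x Hx); left; auto |].
    intros Y' HY'. apply HL'. intros x Hx [H' | H']; [apply (HY' x); auto | apply (HL x Hx); right; auto].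
Qed.

End DirectSum.
(** * Packings and exact states *)

Lemma functional_choice {A B : Type} (R : A -> B -> Prop) :
  (forall a, exists b, R a b) -> exists f, forall a, R a (f a).
Proof.
  intro H. exists (fun a => proj1_sig (constructive_indefinite_description _ (H a))).
  intro a. apply proj2_sig.
Qed.

Lemma dependent_choice {A : Type} (Inv : A -> Prop) (R : nat -> A -> A -> Prop) (a0 : A) :
  Inv a0 -> (forall n a, Inv a -> exists b, Inv b /\ R n a b) ->
  exists s : nat -> A, s 0 = a0 /\ forall n, Inv (s n) /\ R n (s n) (s (S n)).
Proof.
  intros H0 Hs.
  destruct (functional_choice (fun (p : nat * A) b => Inv (snd p) -> Inv b /\ R (fst p) (snd p) b))
    as (F & HF).
  { intros (n & a). destruct (classic (Inv a)) as [Ha | Ha].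
    - destruct (Hs n a Ha) as (b & Hb). exists b; auto.
    - exists a; simpl; tauto. }
  set (s := nat_rect (fun _ => A) a0 (fun n a => F (n, a))).
  assert (Hi : forall n, Inv (s n)).
  { induction n as [| n IH]; [exact H0 | exact (proj1 (HF (n, s n) IH))]. }
  exists s. split; [reflexivity |]. intro n. split; [auto |].
  exact (proj2 (HF (n, s n) (Hi n))).
Qed.

Section Packings.
Context {T Θ : Type} (E : @set T) (c : Θ -> @set T -> @set T) (co : Θ -> @set T).
Context (Hc : forall i, closure_system (c i) (co i)).

Lemma c_mono i X Y : subset X Y -> subset (c i X) (c i Y).
Proof. apply (Hc i). Qed.

Lemma c_ext i X : subset X (c i X).
Proof. apply (Hc i). Qed.

Lemma c_trans i X Y : subset X (c i Y) -> subset (c i X) (c i Y).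
Proof. intros H x Hx. apply (cs_idem _ _ (Hc i)). exact (c_mono i _ _ H x Hx). Qed.

Lemma c_exch i X x y : c i (add X x) y -> ~ c i X y -> c i (add X y) x.
Proof. apply (Hc i). Qed.

Lemma c_circ i S e : c i S e -> ~ S e ->
  exists C, subset C S /\ c i C e /\ forall z, C z -> ~ c i (rem C z) e.
Proof. apply (Hc i). Qed.

Lemma c_sum i X e : co i e -> c i X e -> c i (setI X (co i)) e.
Proof. apply (Hc i). Qed.

Lemma circuit_exchange i C e z : c i C e -> C z -> ~ c i (rem C z) e -> c i (add (rem C z) e) z.
Proof.
  intros He Hz Hn. apply c_exch; auto. apply (c_mono i C); auto.
  intros y Hy. destruct (classic (y = z)); [right | left; split]; auto.
Qed.

(* [O i] is the set of elements still allowed to be used for the index [i]; elsewhere an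
   element is treated as a loop of the i-th matroid. [Q] is a contracted set. *)
Definition packQ (O Q : Θ -> @set T) (X : @set T) (S : Θ -> @set T) : Prop :=
  subset X E /\ (forall i x, S i x -> X x /\ O i x) /\
  (forall i j x, S i x -> S j x -> i = j) /\
  (forall i x, X x -> O i x -> c i (setU (S i) (Q i)) x).

Definition pack (O : Θ -> @set T) (X : @set T) (S : Θ -> @set T) : Prop :=
  subset X E /\ (forall i x, S i x -> X x /\ O i x) /\
  (forall i j x, S i x -> S j x -> i = j) /\
  (forall i x, X x -> O i x -> c i (S i) x).

Definition unused (S : Θ -> @set T) (x : T) : Prop := forall i, ~ S i x.

(* The condition r_1(X) + ... + r_k(X) >= |X| of finite matroid theory. *)
Definition exact (O : Θ -> @set T) : Prop :=
  forall X S x, pack O X S -> X x -> ~ unused S x.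

Lemma pack_packQ O X S : pack O X S <-> packQ O (fun _ => set0) X S.
Proof.
  split; intros (H1 & H2 & H3 & H4); (split; [| split; [| split]]); auto.
  - intros i x Hx Ho. apply (c_mono i (S i)); auto. intros y Hy; left; auto.
  - intros i x Hx Ho. apply (c_mono i (setU (S i) set0)); auto. intros y [Hy | []]; auto.
Qed.

Definition swap (S : Θ -> @set T) (i : Θ) (l z : T) : Θ -> @set T :=
  fun k x => (S k x /\ x <> z) \/ (k = i /\ x = l).

(* The unused element [l] enters the i-th part and displaces an element of its circuit,
   which becomes the new unused element. *)
Inductive walk (O S0 : Θ -> @set T) (l0 : T) : (Θ -> @set T) -> T -> Prop :=
| walk_start : walk O S0 l0 S0 l0
| walk_step S l i C z : walk O S0 l0 S l -> O i l -> subset C (S i) -> c i C l ->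
    (forall y, C y -> ~ c i (rem C y) l) -> C z -> walk O S0 l0 (swap S i l z) z.

Lemma walk_pack O Q X S0 l0 S l : packQ O Q X S0 -> X l0 -> unused S0 l0 ->
  walk O S0 l0 S l -> packQ O Q X S /\ X l /\ unused S l.
Proof.
  intros HP Hl0 Hu0 Hw. induction Hw as [| S l i C z Hw IH Ho HCS HC Hmin Hz]; auto.
  destruct IH as ((H1 & H2 & H3 & H4) & Hl & Hu).
  assert (Hzl : z <> l) by (intro; subst; apply (Hu i); auto).
  assert (Hzi : S i z) by auto.
  split; [split; [auto | split; [| split]] | split].
  - intros k x [[Hx _] | [-> ->]]; auto.
  - intros k k' x [[Hx Hxz] | [-> ->]] [[Hx' Hxz'] | [-> Hx']]; eauto.
    + subst. exfalso; apply (Hu k); auto.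
    + exfalso; apply (Hu k'); auto.
  - intros k x Hx Hox. apply (c_trans k (setU (S k) (Q k))); [| auto].
    intros y [Hy | Hy]; [| apply c_ext; right; auto].
    destruct (classic (y = z)) as [-> | Hyz]; [| apply c_ext; left; left; auto].
    assert (k = i) by eauto. subst k.
    apply (c_mono i (add (rem C z) l)).
    + intros w [[Hw' Hwz] | Hw']; left; [left; split | right; split]; auto.
    + apply circuit_exchange; auto.
  - apply (H2 i z Hzi).
  - intros k [[_ H] | [_ H]]; auto.
Qed.

(** Unless a walk reaches a [v] that some part spans only with the help of [Q], every circuit for
    inserting a reachable element consists of reachable elements. The original parts, cut down to
    these, then pack them without [Q]. *)
Lemma walk_dichotomy O Q X S l : packQ O Q X S -> X l -> unused S l ->
  (exists S' v i, packQ O Q X S' /\ X v /\ unused S' v /\ O i v /\ ~ c i (S' i) v) \/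
  pack O (fun v => exists S', walk O S l S' v) (fun i x => S i x /\ exists S', walk O S l S' x).
Proof.
  intros HP Hl Hu.
  destruct (classic (exists S' v i, walk O S l S' v /\ O i v /\ ~ c i (S' i) v))
    as [(S' & v & i & Hw & Ho & Hn) | Hno].
  { left. destruct (walk_pack O Q X S l S' v) as (H1 & H2 & H3); auto.
    exists S', v, i; auto. }
  right.
  set (R := fun v => exists S', walk O S l S' v).
  (* Induction along the walk: the original parts cut down to [R] span the reachable elements of all
     later parts. *)
  assert (Hcl : forall S' v, walk O S l S' v -> forall i,
    subset (setI (S' i) R) (c i (fun x => S i x /\ R x))).
  { intros S' v Hw. induction Hw as [| S' v i C z Hw IH Ho HCS HC Hmin Hz]; intro k.
    - intros y Hy; apply c_ext; auto.
    - intros y [[[Hy Hyz] | [-> ->]] HyR].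
      + apply IH; split; auto.
      + apply (c_trans i (setI (S' i) R)); [apply IH |].
        apply (c_mono i C); auto. intros w Hw'. split; auto.
        exists (swap S' i v w). eapply walk_step; eauto. }
  split; [| split; [| split]].
  - intros v (S' & Hw). destruct (walk_pack O Q X S l S' v) as (H1 & H2 & H3); auto.
    apply H1; auto.
  - intros i x [Hx HxR]. split; auto. apply HP in Hx; tauto.
  - intros i j x [Hx _] [Hx' _]. apply (proj1 (proj2 (proj2 HP)) i j x); auto.
  - intros i v (S' & Hw) Ho.
    destruct (walk_pack O Q X S l S' v) as (H1 & H2 & H3); auto.
    assert (Hv : c i (S' i) v) by (apply NNPP; intro; apply Hno; exists S', v, i; auto).
    destruct (c_circ i _ _ Hv (H3 i)) as (C & HCS & HC & Hmin).
    apply (c_trans i (setI (S' i) R)); [apply (Hcl S' v Hw) |].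
    apply (c_mono i C); auto. intros w Hw'. split; auto.
    exists (swap S' i v w). eapply walk_step; eauto.
Qed.

Lemma unused_anywhere O X S l e : pack O X S -> X l -> unused S l -> X e ->
  (exists S', pack O X S' /\ unused S' e) \/
  exists R S', pack O R S' /\ ~ R e /\ R l /\ unused S' l.
Proof.
  intros HP Hl Hu He.
  destruct (walk_dichotomy O (fun _ => set0) X S l) as [(S' & v & i & HS & Hv & Huv & Ho & Hn) | HR]; auto.
  - apply pack_packQ; auto.
  - exfalso. apply Hn. apply pack_packQ in HS. apply HS; auto.
  - destruct (classic (exists S', walk O S l S' e)) as [(S' & Hw) | Hw].
    + left. exists S'. destruct (walk_pack O (fun _ => set0) X S l S' e) as (H1 & H2 & H3); auto.
      * apply pack_packQ; auto.
      * split; auto. apply pack_packQ; auto.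
    + right. exists (fun v => exists S', walk O S l S' v), (fun i x => S i x /\ exists S', walk O S l S' x).
      split; [auto | split; [auto | split]].
      * exists S. constructor.
      * intros i [H _]; exact (Hu i H).
Qed.

Definition agree_off (e : T) (O P : Θ -> @set T) : Prop :=
  forall i x, x <> e -> (O i x <-> P i x).

Lemma pack_agree_off e O P X S : agree_off e O P -> ~ X e -> pack O X S -> pack P X S.
Proof.
  intros Ha He (H1 & H2 & H3 & H4). split; [auto | split; [| split; [auto |]]].
  - intros i x Hx. destruct (H2 i x Hx) as [HX Ho]. split; auto.
    apply Ha; auto. intro; subst; auto.
  - intros i x Hx Ho. apply H4; auto. apply Ha; auto. intro; subst; auto.
Qed.

Lemma exact_of_new_element e O P : agree_off e O P -> exact O ->
  (forall X S, ~ X e -> pack O X S -> ~ forall i, P i e -> c i (S i) e) -> exact P.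
Proof.
  intros Ha HO HP X S l HX Hl Hu.
  assert (Ha' : agree_off e P O) by (intros i x Hx; symmetry; apply Ha; auto).
  destruct (classic (X e)) as [He | He].
  2:{ apply (HO X S l); auto. apply (pack_agree_off e P); auto. }
  destruct (unused_anywhere P X S l e) as [(S' & HS' & Hue) | (R & S' & HR & HRe & HRl & HRu)]; auto.
  - apply (HP (rem X e) S'); [intros [_ H]; apply H; reflexivity | |].
    + apply (pack_agree_off e P); auto; [intros [_ H]; apply H; reflexivity |].
      destruct HS' as (H1 & H2 & H3 & H4). split; [| split; [| split; [auto |]]].
      * intros x [Hx _]; auto.
      * intros i x Hx. destruct (H2 i x Hx) as [Hx1 Hx2]. split; auto. split; auto.
        intro H; unfold set1 in H; subst; apply (Hue i); auto.
      * intros i x [Hx _]; auto.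
    + intros i Hi. apply HS'; auto.
  - apply (HO R S' l); auto. apply (pack_agree_off e P); auto.
Qed.

(* [Y] may be packed with respect to fewer allowed pairs [P] as long as these contain the
   part of the packing of [X] that is discarded. *)
Lemma pack_union O P X Y S B :
  (forall i x, P i x -> O i x) -> pack P Y B -> pack O X S ->
  (forall i x, S i x -> Y x -> P i x) -> (forall i x, Y x -> ~ X x -> O i x -> P i x) ->
  pack O (setU Y X) (fun i => setU (B i) (setD (S i) Y)).
Proof.
  intros HPO (B1 & B2 & B3 & B4) (S1 & S2 & S3 & S4) HSP HYP.
  split; [| split; [| split]].
  - intros x [Hx | Hx]; auto.
  - intros i x [Hx | [Hx _]].
    + destruct (B2 i x Hx); split; [left |]; auto.
    + destruct (S2 i x Hx); split; [right |]; auto.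
  - intros i j x [Hx | [Hx Hn]] [Hx' | [Hx' Hn']]; eauto.
    + exfalso; apply Hn'; apply (B2 i x Hx).
    + exfalso; apply Hn; apply (B2 j x Hx').
  - intros i x HYX Ho.
    assert (HSi : subset (S i) (c i (setU (B i) (setD (S i) Y)))).
    { intros s Hs. destruct (classic (Y s)) as [HY | HY].
      - apply (c_mono i (B i)); [intros y Hy; left; auto |]. apply B4; auto.
      - apply c_ext; right; split; auto. }
    destruct (classic (X x)) as [HX | HX].
    + apply (c_trans i (S i)); auto.
    + destruct HYX as [HY | HY]; [| tauto].
      apply (c_mono i (B i)); [intros y Hy; left; auto |]. apply B4; auto.
Qed.

(** * Committing elements to a single index *)

Definition commit (O : Θ -> @set T) (X : @set T) (S : Θ -> @set T) : Θ -> @set T :=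
  fun i x => O i x /\ (X x -> S i x).

Lemma commit_exact O X S : exact O -> pack O X S -> exact (commit O X S).
Proof.
  intros HO HX Y B l HY Hl Hu.
  apply (HO _ _ l (pack_union O (commit O X S) X Y S B (fun i x H => proj1 H) HY HX
    (fun i x Hs Hy => conj (proj2 (proj1 (proj2 HX) i x Hs)) (fun _ => Hs))
    (fun i x Hy Hx Ho => conj Ho (fun H => False_ind _ (Hx H))))).
  - left; auto.
  - intros i [H | [_ H]]; [exact (Hu i H) | auto].
Qed.

Definition committed (O : Θ -> @set T) (e : T) (i : Θ) : Prop :=
  E e /\ O i e /\ forall k, O k e -> k = i.

Lemma committed_pack O C : (forall z, C z -> exists i, committed O z i) ->
  pack O C (fun i x => C x /\ committed O x i).
Proof.
  intro HC. split; [| split; [| split]].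
  - intros x Hx. destruct (HC x Hx) as (i & H & _); auto.
  - intros i x (Hx & _ & H & _); auto.
  - intros i j x (_ & _ & _ & H) (_ & _ & H' & _). symmetry; auto.
  - intros i x Hx Ho. apply c_ext. split; auto.
    destruct (HC x Hx) as (k & Hk). rewrite (proj2 (proj2 Hk) i Ho). exact Hk.
Qed.

Context (num : T -> nat) (Hnum : forall x y, E x -> E y -> num x = num y -> x = y).

(** Countability allows choosing one packing per element that can be packed at all. Each element
    keeps its role in the first chosen packing covering it; by strong induction the earlier parts
    span what later packings lose. *)
Lemma largest_pack O : exists W S, pack O W S /\ forall X B, pack O X B -> subset X W.
Proof.
  destruct (functional_choice (fun n (p : @set T * (Θ -> @set T)) =>
    pack O (fst p) (snd p) /\
    forall X B e, pack O X B -> X e -> num e = n -> fst p e)) as (F & HF).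
  { intro n. destruct (classic (exists X B e, pack O X B /\ X e /\ num e = n))
      as [(X & B & e & HX & He & Hn) | Hno].
    - exists (X, B). split; auto. intros X' B' e' HX' He' Hn'. simpl.
      replace e' with e; auto. apply Hnum; [apply HX | apply HX' |]; auto. congruence.
    - exists (set0, fun _ => set0). split; [| intros X B e H1 H2 H3; exfalso; eauto 7].
      split; [| split; [| split]]; simpl; intros; try contradiction; intros x Hx; contradiction. }
  set (S := fun i x => exists n, snd (F n) i x /\ forall m, m < n -> ~ fst (F m) x).
  exists (fun x => exists n, fst (F n) x), S. split.
  2:{ intros X B HX x Hx. exists (num x). apply (proj2 (HF (num x)) X B x); auto. }
  assert (Hs : forall n i x, fst (F n) x -> O i x -> c i (S i) x).
  { induction n as [n IH] using lt_wf_ind. intros i x Hx Ho.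
    destruct (proj1 (HF n)) as (H1 & H2 & H3 & H4).
    apply (c_trans i (snd (F n) i)); auto. intros s Hs.
    destruct (classic (exists m, m < n /\ fst (F m) s)) as [(m & Hm & Hms) | Hno].
    - apply (IH m); auto. apply (H2 i s Hs).
    - apply c_ext. exists n. split; auto. intros m Hm Hms. apply Hno; eauto. }
  split; [| split; [| split]].
  - intros x (n & Hx). apply (proj1 (HF n)); auto.
  - intros i x (n & Hx & _). destruct (proj1 (HF n)) as (H1 & H2 & _).
    destruct (H2 i x Hx). eauto.
  - intros i j x (n & Hx & Hn) (m & Hy & Hm).
    destruct (proj1 (HF n)) as (_ & H2 & H3 & _).
    destruct (proj1 (HF m)) as (_ & H2' & _ & _).
    destruct (lt_eq_lt_dec n m) as [[H | H] | H].
    + exfalso; apply (Hm n H), (H2 i x Hx).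
    + subst; eauto.
    + exfalso; apply (Hn m H), (H2' j x Hy).
  - intros i x (n & Hx). eauto.
Qed.

Lemma committed_in_pack O X S x i : exact O -> pack O X S -> X x -> committed O x i -> S i x.
Proof.
  intros HO HX Hx (_ & _ & Hi). apply NNPP; intro Hn.
  apply (HO X S x HX Hx). intros k Hk. apply Hn.
  rewrite <- (Hi k); auto. apply (proj1 (proj2 HX) k x Hk).
Qed.

Definition refines (P O : Θ -> @set T) : Prop :=
  (forall i x, P i x -> O i x) /\ forall x i, committed O x i -> committed P x i.

Lemma refines_refl P : refines P P.
Proof. split; auto. Qed.

Lemma commit_refines O X S : exact O -> pack O X S -> refines (commit O X S) O.
Proof.
  intros HO HX. split; [intros i x [H _]; auto |].
  intros x i Hx. split; [apply Hx | split].
  - split; [apply Hx |]. intro HxX. eapply committed_in_pack; eauto.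
  - intros k [Hk _]. apply Hx; auto.
Qed.

Lemma commit_committed O X S i x : pack O X S -> S i x -> committed (commit O X S) x i.
Proof.
  intros (H1 & H2 & H3 & H4) Hx. destruct (H2 i x Hx) as [HX Ho].
  split; [auto | split; [split; auto |]].
  intros k [_ Hk]. eauto.
Qed.

(** If [e] lies in the largest packed set, that packing is committed. Otherwise some allowed [i] has
    [e] outside the span of its part, since [e] cannot be adjoined; every packed set lies in the
    largest one, so no packing spans [e] for [i], and [e] may be committed to [i]. *)
Lemma commit_element O e : exact O -> E e ->
  exists P, exact P /\ refines P O /\ exists i, committed P e i.
Proof.
  intros HO He. destruct (largest_pack O) as (W & S & HW & Hmax).
  destruct (classic (W e)) as [HeW | HeW].
  { exists (commit O W S). split; [apply commit_exact; auto |].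
    split; [apply commit_refines; auto |].
    destruct (classic (exists i, S i e)) as [(i & Hi) | Hno].
    - exists i. apply commit_committed; auto.
    - exfalso. apply (HO W S e HW HeW). intros i Hi; eauto. }
  destruct (classic (exists i, O i e /\ ~ c i (S i) e)) as [(i & Hi & Hn) | Hno].
  2:{ exfalso. apply HeW. apply (Hmax (add W e) S); [| right; reflexivity].
      destruct HW as (H1 & H2 & H3 & H4). split; [| split; [| split]]; auto.
      - intros x [Hx | Hx]; auto. unfold set1 in Hx; subst; auto.
      - intros i x Hx. destruct (H2 i x Hx). split; [left |]; auto.
      - intros i x [Hx | Hx] Ho; auto. unfold set1 in Hx; subst.
        apply NNPP; intro; apply Hno; eauto. }
  set (P := fun k x => O k x /\ (x = e -> k = i)).
  exists P. split; [| split; [split |]].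
  - apply (exact_of_new_element e O); auto.
    + intros k x Hx. split; [intro; split; tauto | intros [H _]; auto].
    + intros X B HXe HX Hall. apply Hn.
      apply (c_trans i (B i)); [| apply Hall; split; auto].
      intros b Hb. destruct (proj1 (proj2 HX) i b Hb) as [HbX Hbo].
      apply HW; auto. apply (Hmax X B HX); auto.
  - intros k x [H _]; auto.
  - intros x k (Hx & Ho & Hk). split; auto. split.
    + split; auto. intro; subst. symmetry; auto.
    + intros k' [H _]; auto.
  - exists i. split; [auto | split; [split; auto | intros k [_ H]; auto]].
Qed.

End Packings.
(** * Certifying elements in cofinitary matroids *)

Section Certification.
Context {T Θ : Type} (E : @set T) (c : Θ -> @set T -> @set T) (co : Θ -> @set T).
Context (Hc : forall i, closure_system (c i) (co i)).
Context (num : T -> nat) (Hnum : forall x y, E x -> E y -> num x = num y -> x = y).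

(** Vacuous once [i] is not allowed for [e], so the certificate survives a move of [e] elsewhere. *)
Definition certified (P : Θ -> @set T) (e : T) (i : Θ) : Prop :=
  P i e -> ~ c i (rem (P i) e) e.

Definition moved (P P' : Θ -> @set T) (e : T) (j : Θ) : Prop :=
  forall k x, P' k x <-> (x <> e /\ P k x) \/ (x = e /\ k = j).

(** In the cofinitary summand [e] must avoid the span of everything still allowed for [j], to
    protect certificates; in the finitary one, avoiding the spans of packings suffices for
    exactness. *)
Definition movable (P : Θ -> @set T) (e : T) (j : Θ) : Prop :=
  (co j e -> ~ c j (P j) e) /\
  (~ co j e -> forall X S, pack E c P X S -> ~ c j (S j) e).

(** [O] is the initial state: a move may lead back to an index that [O] allowed but [P] has
    discarded. *)
Inductive step (O P P' : Θ -> @set T) : Prop :=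
| step_refine : exact E c P' -> refines E P' P -> step O P P'
| step_move e i j : committed E P e i -> i <> j -> O j e -> movable P e j ->
    moved P P' e j -> step O P P'.

Inductive reach (O P : Θ -> @set T) : (Θ -> @set T) -> Prop :=
| reach_refl : reach O P P
| reach_step P1 P2 : reach O P P1 -> step O P1 P2 -> reach O P P2.

Lemma reach_trans O P P1 P2 : reach O P P1 -> reach O P1 P2 -> reach O P P2.
Proof. intros H1 H2; induction H2; auto. eapply reach_step; eauto. Qed.

Lemma reach_one O P P' : step O P P' -> reach O P P'.
Proof. apply reach_step, reach_refl. Qed.

Lemma movable_not_spanned P e j : movable P e j ->
  forall X S, pack E c P X S -> ~ c j (S j) e.
Proof.
  intros [H1 H2] X S HX. destruct (classic (co j e)) as [H | H]; [| eauto].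
  intro Hs. apply (H1 H). apply (c_mono c co Hc j (S j)); auto. intros y Hy; apply HX in Hy; tauto.
Qed.

Lemma moved_committed P P' e j : E e -> moved P P' e j -> committed E P' e j.
Proof.
  intros He Hm. split; [auto | split].
  - apply Hm; right; auto.
  - intros k Hk. apply Hm in Hk. tauto.
Qed.

Lemma moved_exact P P' e i j : exact E c P -> committed E P e i -> movable P e j ->
  moved P P' e j -> exact E c P'.
Proof.
  intros HP He Hmov Hm. apply (exact_of_new_element E c co Hc e P); auto.
  - intros k x Hx. split; intro H; [apply Hm; auto | apply Hm in H; tauto].
  - intros X S _ HX Hall. apply (movable_not_spanned P e j Hmov X S HX), Hall.
    apply Hm; auto.
Qed.

Lemma step_invariant O P P' : step O P P' -> exact E c P -> (forall i x, P i x -> O i x) ->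
  exact E c P' /\ forall i x, P' i x -> O i x.
Proof.
  intros [HP' [Hr _] | e i j He Hij Hj Hmov Hm] HP HPO.
  - split; auto.
  - split; [eapply moved_exact; eauto |].
    intros k x Hx. apply Hm in Hx. destruct Hx as [[_ Hx] | [-> ->]]; auto.
Qed.

Lemma reach_invariant O P P' : reach O P P' -> exact E c P -> (forall i x, P i x -> O i x) ->
  exact E c P' /\ forall i x, P' i x -> O i x.
Proof.
  intros Hr HP HPO. induction Hr as [| P1 P2 _ [IH1 IH2] Hs]; auto.
  eapply step_invariant; eauto.
Qed.

Lemma step_committed O P P' x : step O P P' -> (exists i, committed E P x i) ->
  exists i, committed E P' x i.
Proof.
  intros [HP' [_ Hr] | e i j He Hij Hj Hmov Hm] (k & Hk); eauto.
  destruct (classic (x = e)) as [-> | Hx].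
  - exists j. eapply moved_committed; eauto. apply He.
  - exists k. destruct Hk as (H1 & H2 & H3). split; [auto | split].
    + apply Hm; auto.
    + intros k' Hk'. apply Hm in Hk'. destruct Hk' as [[_ H] | [H _]]; auto. tauto.
Qed.

(** The critical case is a move of another [e] into [i]. If [e] helped to span [x], exchange would
    put [e] into the span of what was allowed before, against movability; an [e] outside the
    cofinitary summand cannot help. *)
Lemma step_certified O P P' x i : step O P P' -> co i x -> certified P x i -> certified P' x i.
Proof.
  intros [HP' [Hr _] | e k j He Hij Hj [Hm1 Hm2] Hm] Hco Hx.
  - intros Hxi Hs. apply (Hx (Hr _ _ Hxi)). apply (c_mono c co Hc i (rem (P' i) x)); auto.
    intros y [Hy Hyx]; split; auto.
  - intros Hxi Hs.
    destruct (classic (i = j)) as [-> | Hne].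
    2:{ apply Hm in Hxi. destruct Hxi as [[Hxe Hxi] | [_ H]]; [| tauto].
        apply (Hx Hxi). apply (c_mono c co Hc i (rem (P' i) x)); auto.
        intros y [Hy Hyx]; split; auto. apply Hm in Hy. tauto. }
    destruct (classic (x = e)) as [-> | Hxe].
    { apply (Hm1 Hco). apply (c_mono c co Hc j (rem (P' j) e)); auto.
      intros y [Hy Hye]. apply Hm in Hy. unfold set1 in Hye. tauto. }
    assert (Hxj : P j x) by (apply Hm in Hxi; tauto).
    apply (Hx Hxj). destruct (classic (co j e)) as [Hce | Hce].
    + apply NNPP; intro Hn. apply (Hm1 Hce).
      apply (c_mono c co Hc j (add (rem (P j) x) x)).
      * intros y [[Hy _] | Hy]; auto. unfold set1 in Hy; subst; auto.
      * apply c_exch with (co := co); auto.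
        apply (c_mono c co Hc j (rem (P' j) x)); auto.
        intros y [Hy Hyx]. apply Hm in Hy.
        destruct Hy as [[_ Hy] | [-> _]]; [left; split | right; reflexivity]; auto.
    + apply (c_sum c co Hc) in Hs; auto.
      apply (c_mono c co Hc j (setI (rem (P' j) x) (co j))); auto.
      intros y [[Hy Hyx] Hyc]. split; auto. apply Hm in Hy.
      destruct Hy as [[_ Hy] | [-> _]]; [auto | tauto].
Qed.

Lemma reach_committed O P P' x : reach O P P' -> (exists i, committed E P x i) ->
  exists i, committed E P' x i.
Proof. intros Hr; induction Hr; auto. intro; eapply step_committed; eauto. Qed.

Lemma reach_certified O P P' x i : reach O P P' -> co i x -> certified P x i -> certified P' x i.
Proof. intros Hr; induction Hr; auto. intros; eapply step_certified; eauto. Qed.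

Definition dead (O P : Θ -> @set T) (e : T) (i : Θ) : Prop :=
  forall P', reach O P P' -> committed E P' e i.

Lemma dead_committed O P e i : dead O P e i -> committed E P e i.
Proof. intro H; apply H, reach_refl. Qed.

Lemma dead_reach O P P' e i : reach O P P' -> dead O P e i -> dead O P' e i.
Proof. intros Hr H P2 H2. apply H. eapply reach_trans; eauto. Qed.

Lemma dead_not_movable O P e i j : dead O P e i -> i <> j -> O j e -> ~ movable P e j.
Proof.
  intros Hd Hij Ho Hm. apply Hij.
  set (P' := fun k x => (x <> e /\ P k x) \/ (x = e /\ k = j)).
  assert (H : committed E P' e i).
  { apply Hd, reach_one. apply (step_move O P P' e i j); auto.
    - apply (dead_committed O); auto.
    - intros k x; reflexivity. }
  symmetry. apply H. right; auto.
Qed.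

Lemma dead_spanned_cofinitary O P e i j : dead O P e i -> i <> j -> O j e -> co j e ->
  c j (P j) e.
Proof.
  intros Hd Hij Ho Hco. apply NNPP; intro Hn.
  apply (dead_not_movable O P e i j); auto. split; [auto | tauto].
Qed.

(* When [z] leaves, [e] can take its place. *)
Lemma dead_of_cocircuit O P e i j z : dead O P e i -> i <> j -> O j e -> co j e ->
  committed E P z j -> ~ c j (rem (P j) z) e -> dead O P z j.
Proof.
  intros Hd Hij Ho Hco Hz Hn.
  (* The induction must also carry that [z] remains indispensable for spanning [e]. *)
  assert (Hboth : forall P', reach O P P' -> committed E P' z j /\ ~ c j (rem (P' j) z) e).
  2:{ intros P' HP'; apply Hboth; auto. }
  intros P' Hr. induction Hr as [| P1 P2 Hr [IH1 IH2] Hs]; auto.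
  assert (Hd2 : dead O P2 e i) by (apply (dead_reach O P); auto; eapply reach_step; eauto).
  assert (Hd1 : dead O P1 e i) by (apply (dead_reach O P); auto).
  destruct Hs as [HP' [Hr1 Hr2] | x k j' Hx Hkj Hj' [Hm1 Hm2] Hm].
  - split; auto. intro H; apply IH2. apply (c_mono c co Hc j (rem (P2 j) z)); auto.
    intros y [Hy Hyz]; split; auto.
  - destruct (classic (x = z)) as [-> | Hxz].
    + exfalso. assert (k = j) by (symmetry; apply Hx; apply IH1). subst k.
      apply (dead_not_movable O P2 e i j); auto. split; [| tauto].
      intros _ H. apply IH2. apply (c_mono c co Hc j (P2 j)); auto.
      intros y Hy. apply Hm in Hy. destruct Hy as [[Hyz Hy] | [_ Hy]]; [split; auto | congruence].
    + assert (Hxe : x <> e).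
      { intro; subst x. apply Hkj.
        rewrite <- (proj2 (proj2 Hx) i (proj1 (proj2 (dead_committed _ _ _ _ Hd1)))).
        symmetry. apply (dead_committed _ _ _ _ Hd2), Hm; auto. }
      split.
      * destruct IH1 as (H1 & H2 & H3). split; [auto | split].
        -- apply Hm; auto.
        -- intros k' Hk'. apply Hm in Hk'. destruct Hk' as [[_ H] | [H _]]; auto.
           exfalso; auto.
      * intro H. apply IH2. destruct (classic (j' = j)) as [-> | Hne].
        2:{ apply (c_mono c co Hc j (rem (P2 j) z)); auto.
            intros y [Hy Hyz]; split; auto. apply Hm in Hy.
            destruct Hy as [[_ Hy] | [_ Hy]]; congruence. }
        destruct (classic (co j x)) as [Hcx | Hcx].
        -- apply NNPP; intro Hn1. apply (Hm1 Hcx).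
           apply (c_trans c co Hc j (add (rem (P1 j) z) e)).
           ++ intros y [[Hy _] | Hy]; [apply (c_ext c co Hc); auto |].
              unfold set1 in Hy; subst y. apply (dead_spanned_cofinitary O P1 e i j); auto.
           ++ apply (c_exch c co Hc); auto.
              apply (c_mono c co Hc j (rem (P2 j) z)); auto.
              intros y [Hy Hyz]. apply Hm in Hy.
              destruct Hy as [[_ Hy] | [-> _]]; [left; split | right; reflexivity]; auto.
        -- apply (c_sum c co Hc) in H; auto.
           apply (c_mono c co Hc j (setI (rem (P2 j) z) (co j))); auto.
           intros y [[Hy Hyz] Hyc]. split; auto. apply Hm in Hy.
           destruct Hy as [[_ Hy] | [-> _]]; [auto | tauto].
Qed.

(* If [z] moves from [j] to [k], then [e], which has a circuit through [z] among the elements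
   committed to [j], becomes movable to [j]: otherwise a packing after the move, with [z]
   declared unused, yields a packing before the move which spans [z] in the k-th matroid. *)
Lemma circuit_released P1 P2 C e j k z : exact E c P1 -> exact E c P2 ->
  committed E P1 z j -> j <> k ->
  (forall X S, pack E c P1 X S -> ~ c k (S k) z) -> moved P1 P2 z k ->
  (forall y, C y -> committed E P1 y j) -> c j C e -> C z -> ~ c j (rem C z) e ->
  forall X B, pack E c P2 X B -> ~ c j (B j) e.
Proof.
  intros HP1 HP2 Hz Hjk Hmov Hm HC HCe HCz Hmin X0 B0 HX0 He0.
  assert (Hz2 : committed E P2 z k) by (eapply moved_committed; eauto; apply Hz).
  assert (HC2 : forall y, C y -> exists i, committed E P2 y i).
  { intros y Hy. destruct (classic (y = z)) as [-> | Hyz]; [eauto |]. exists j.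
    destruct (HC y Hy) as (H1 & H2 & H3). split; [auto | split].
    - apply Hm; auto.
    - intros k' Hk'. apply Hm in Hk'. destruct Hk' as [[_ H] | [H _]]; auto. tauto. }
  (* The packed set is enlarged by [C], which is packed by its own commitments, so that the whole
     circuit lies in it. *)
  assert (HX1 := pack_union E c co Hc P2 P2 _ _ _ _ (fun _ _ H => H) HX0
    (committed_pack E c co Hc P2 C HC2)
    (fun i x H _ => proj1 (proj2 (proj2 H))) (fun _ _ _ _ H => H)).
  set (X := setU X0 C) in HX1.
  match type of HX1 with pack _ _ _ _ ?b => set (B := b) in HX1 end.
  assert (HCX : subset C X) by (intros y Hy; right; auto).
  assert (He : c j (B j) e).
  { apply (c_mono c co Hc j (B0 j)); auto. intros y Hy; left; auto. }
  assert (HzB : c j (B j) z).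
  { apply (c_trans c co Hc j (add (rem C z) e)).
    - intros y [[Hy Hyz] | Hy]; [| unfold set1 in Hy; subst; auto].
      apply HX1; auto. apply Hm; left; split; auto. apply HC; auto.
    - apply (circuit_exchange c co Hc); auto. }
  assert (Hzk : B k z) by (apply (committed_in_pack E c P2 X B z k HP2 HX1); auto).
  clearbody B. clear HX0 He0 B0.
  set (S0 := fun i x => B i x /\ x <> z).
  set (Q := fun (i : Θ) (x : T) => i = k /\ x = z).
  destruct HX1 as (B1 & B2 & B3 & B4).
  assert (HPQ : packQ E c P1 Q X S0).
  { split; [auto | split; [| split]].
    - intros i x [Hx Hxz]. destruct (B2 i x Hx) as [HX Hx2]. split; auto.
      apply Hm in Hx2. tauto.
    - intros i i' x [Hx _] [Hx' _]. eauto.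
    - intros i x Hx Hx1. apply (c_mono c co Hc i (B i)).
      + intros y Hy. destruct (classic (y = z)) as [-> | Hyz]; [right | left; split]; auto.
        split; eauto.
      + destruct (classic (x = z)) as [-> | Hxz].
        * rewrite (proj2 (proj2 Hz) i Hx1). auto.
        * apply B4; auto. apply Hm; auto. }
  assert (Hzu : unused S0 z) by (intros i [_ H]; auto).
  destruct (walk_dichotomy E c co Hc P1 Q X S0 z) as [(S' & v & i & HS & Hv & Huv & Ho & Hn) | HR]; auto.
  2:{ apply (HP1 _ _ z HR).
      - exists S0. constructor.
      - intros i [H _]. exact (Hzu i H). }
  destruct HS as (S1 & S2 & S3 & S4).
  destruct (classic (i = k)) as [-> | Hik].
  2:{ apply Hn, (c_mono c co Hc i (setU (S' i) (Q i))); auto.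
      intros y [Hy | [H _]]; [auto | tauto]. }
  (* Only with the help of [z] is [v] spanned here, so by exchange [v] can replace [z]. This gives a
     packing for [P1] that spans [z] in the [k]-th matroid. *)
  assert (Hzv : c k (add (S' k) v) z).
  { apply (c_exch c co Hc); auto. apply (c_mono c co Hc k (setU (S' k) (Q k))); auto.
    intros y [Hy | [_ Hy]]; [left | right]; auto. }
  apply (Hmov X (fun i x => S' i x \/ (i = k /\ x = v))).
  - split; [auto | split; [| split]].
    + intros i x [Hx | [-> ->]]; auto.
    + intros i i' x [Hx | [-> ->]] [Hx' | [-> Hx']]; eauto.
      * subst. exfalso; exact (Huv i Hx).
      * exfalso; exact (Huv i' Hx').
    + intros i x Hx Hxi. apply (c_trans c co Hc i (setU (S' i) (Q i))); auto.
      intros y [Hy | [-> ->]]; [apply (c_ext c co Hc); auto |].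
      apply (c_mono c co Hc k (add (S' k) v)); auto.
      intros w [Hw | Hw]; [left | right]; auto.
  - apply (c_mono c co Hc k (add (S' k) v)); auto.
    intros w [Hw | Hw]; [left | right]; auto.
Qed.

(** By [circuit_released], the first element of [C] to move away from [j] would make the dead [e]
    movable to [j]. *)
Lemma dead_of_committed_circuit O P C e i j : exact E c P -> (forall i x, P i x -> O i x) ->
  dead O P e i -> i <> j -> O j e -> ~ co j e ->
  (forall z, C z -> committed E P z j) -> c j C e ->
  (forall z, C z -> ~ c j (rem C z) e) -> forall z, C z -> dead O P z j.
Proof.
  intros HP HPO Hd Hij Ho Hco HC HCe Hmin z Hz P' HP'. revert z Hz.
  induction HP' as [| P1 P2 Hr IH Hs]; auto.
  destruct (reach_invariant O P P1 Hr HP HPO) as [HP1 HPO1].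
  assert (Hs' := Hs).
  destruct Hs as [HP' [Hr1 Hr2] | x k j' Hx Hkj Hj' Hmov Hm]; [auto |].
  intros z Hz. destruct (classic (C x)) as [HCx | HCx].
  - exfalso. assert (k = j) by (symmetry; apply Hx; apply (IH x HCx)). subst k.
    apply (dead_not_movable O P2 e i j); auto.
    + apply (dead_reach O P); auto. eapply reach_step; eauto.
    + split; [tauto |]. intros _.
      apply (circuit_released P1 P2 C e j j' x); auto.
      * eapply moved_exact; eauto.
      * apply movable_not_spanned; auto.
  - destruct (IH z Hz) as (H1 & H2 & H3). assert (z <> x) by (intro; subst; auto).
    split; [auto | split].
    + apply Hm; auto.
    + intros k' Hk'. apply Hm in Hk'. destruct Hk' as [[_ H'] | [H' _]]; auto. tauto.
Qed.

Definition hopeless (O P : Θ -> @set T) (e : T) (i : Θ) : Prop :=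
  forall P', reach O P P' -> ~ certified P' e i.

Definition settled (O P : Θ -> @set T) (e : T) : Prop :=
  (exists i, committed E P e i) /\
  forall i, co i e -> certified P e i \/ hopeless O P e i.

Definition saturated (O P : Θ -> @set T) : Prop :=
  forall e i j, dead O P e i -> i <> j -> O j e -> ~ co j e ->
    c j (fun z => committed E P z j) e.

Lemma settled_reach O P P' e : reach O P P' -> settled O P e -> settled O P' e.
Proof.
  intros Hr [H1 H2]. split; [eapply reach_committed; eauto |].
  intros i Hi. destruct (H2 i Hi) as [H | H]; [left; eapply reach_certified; eauto | right].
  intros P2 Hr2. apply H. eapply reach_trans; eauto.
Qed.

(** Leaving [i] would make the certificate for [i] hold vacuously. *)
Lemma hopeless_dead O P e i : committed E P e i -> hopeless O P e i -> dead O P e i.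
Proof.
  intros He Hh P' Hr.
  destruct (reach_committed O P P' e Hr (ex_intro _ i He)) as (k & Hk).
  destruct (classic (P' i e)) as [Hi | Hi].
  - rewrite (proj2 (proj2 Hk) i Hi). exact Hk.
  - exfalso. apply (Hh P' Hr). intro; tauto.
Qed.

Lemma settle O P e : exact E c P -> (forall i x, P i x -> O i x) -> E e ->
  exists P', reach O P P' /\ settled O P' e.
Proof.
  intros HP HPO He.
  destruct (commit_element E c co Hc num Hnum P e HP He) as (P1 & HP1 & Hr1 & i & Hi).
  assert (HrP1 : reach O P P1) by (apply reach_one, step_refine; auto).
  destruct (classic (exists P2, reach O P1 P2 /\ certified P2 e i)) as [(P2 & Hr2 & Hc2) | Hno].
  - exists P2. split; [eapply reach_trans; eauto |].
    split; [eapply reach_committed; eauto |].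
    intros k Hk. left. destruct (classic (P1 k e)) as [H | H].
    + rewrite (proj2 (proj2 Hi) k H). auto.
    + apply (reach_certified O P1); auto. intro; tauto.
  - exists P1. split; [auto |]. split; [eauto |].
    intros k Hk. destruct (classic (P1 k e)) as [H | H].
    + right. rewrite (proj2 (proj2 Hi) k H). intros P2 Hr2 Hc2. apply Hno; eauto.
    + left. intro; tauto.
Qed.

(** The largest packing is committed. As a dead [e] is not movable, some packing of the new state
    spans it in the [j]-th matroid; that packing stays inside the committed set, so its [j]-part
    consists of elements committed to [j]. *)
Lemma saturate O P : exact E c P -> exists P', reach O P P' /\ saturated O P'.
Proof.
  intro HP. destruct (largest_pack E c co Hc num Hnum P) as (W & S & HW & Hmax).
  exists (commit P W S). split.
  { apply reach_one, step_refine; [apply (commit_exact E c co Hc) | apply (commit_refines E c)]; auto. }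
  intros e i j Hd Hij Ho Hco.
  assert (HX : exists X B, pack E c (commit P W S) X B /\ c j (B j) e).
  { apply NNPP; intro Hno. apply (dead_not_movable O _ e i j Hd); auto.
    split; [tauto |]. intros _ X B HX He. apply Hno; eauto. }
  destruct HX as (X & B & HX & He).
  assert (HXW : subset X W).
  { intros x Hx.
    refine (Hmax _ _ (pack_union E c co Hc P (commit P W S) W X S B _ HX HW _ _) x (or_introl Hx)).
    - intros k y [H _]; auto.
    - intros k y Hy _. split; auto. apply HW in Hy; tauto.
    - intros k y _ Hy H. split; tauto. }
  apply (c_mono c co Hc j (B j)); auto.
  intros z Hz. destruct (proj1 (proj2 HX) j z Hz) as [HzX [_ Hz']].
  apply (commit_committed E c P W S j z HW). auto.
Qed.

(** A certified [z] on a circuit of [e] is indispensable for spanning [e], since otherwise the rest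
    of the circuit and [e] would span [z]. The last condition on [z] is the one that forces a
    settled element to be dead in the limit. *)
Lemma spanned_by_undecided O P e j : co j e -> c j (rem (P j) e) e ->
  (forall z, committed E P z j -> ~ c j (rem (P j) z) e -> dead O P z j) ->
  c j (fun z => z <> e /\ P j z /\ co j z /\
    (committed E P z j -> certified P z j -> dead O P z j)) e.
Proof.
  intros Hco He Hdead.
  destruct (c_circ c co Hc j _ _ He) as (C & HC & HCe & Hmin).
  { intros [_ H]; apply H; reflexivity. }
  apply (c_sum c co Hc) in HCe as HCe'; auto.
  apply (c_mono c co Hc j (setI C (co j))); auto.
  intros z [Hz Hzc]. destruct (HC z Hz) as [HzP Hze].
  split; [exact Hze | split; [auto | split; [auto |]]].
  intros Hcom Hcert. apply Hdead; auto. intro Hn. apply (Hcert HzP).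
  apply (c_trans c co Hc j (add (rem C z) e)).
  - intros y [[Hy Hyz] | Hy]; [| unfold set1 in Hy; subst; auto].
    apply (c_ext c co Hc). split; auto. apply HC; auto.
  - apply (circuit_exchange c co Hc); auto.
Qed.

Lemma exact_allowed O x : exact E c O -> E x -> exists i, O i x.
Proof.
  intros HO Hx. apply NNPP; intro Hno.
  apply (HO (set1 x) (fun _ => set0) x); [| reflexivity | intros i []].
  split; [intros y Hy; unfold set1 in Hy; subst; auto |].
  split; [intros i y [] |]. split; [intros i j y [] |].
  intros i y Hy Ho. unfold set1 in Hy; subst. exfalso; eauto.
Qed.

Lemma eventually_avoids (L : list T) (Y : nat -> @set T) :
  (forall x, In x L -> exists m0, forall m, m0 <= m -> ~ Y m x) ->
  exists m0, forall m, m0 <= m -> forall x, In x L -> ~ Y m x.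
Proof.
  induction L as [| a L IH]; intro H.
  - exists 0. intros m _ x [].
  - destruct IH as (m1 & H1); [intros x Hx; apply H; right; auto |].
    destruct (H a) as (m2 & H2); [left; auto |].
    exists (m1 + m2). intros m Hm x [<- | Hx]; [apply H2 | apply H1; auto]; lia.
Qed.

(** * The limit of a run through all elements *)

Section Limit.
Context (O : Θ -> @set T) (HO : exact E c O) (HOE : forall i x, O i x -> E x).
Context (s : nat -> Θ -> @set T) (Hs0 : reach O O (s 0)).
Context (Hreach : forall n, reach O (s n) (s (S n))).
Context (Hsettled : forall n e, E e -> num e = n -> settled O (s (S n)) e).
Context (Hsat : forall n, saturated O (s (S n))).

Lemma sequence_reach n m : n <= m -> reach O (s n) (s m).
Proof.
  intro H; induction H; [apply reach_refl | eapply reach_trans; eauto].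
Qed.

Lemma sequence_invariant n : exact E c (s n) /\ forall i x, s n i x -> O i x.
Proof.
  apply (reach_invariant O O); auto.
  eapply reach_trans; [exact Hs0 | apply sequence_reach; lia].
Qed.

Definition eventually_dead (j : Θ) : set := fun e => exists n, dead O (s n) e j.

Lemma dead_class_unique i j e : eventually_dead i e -> eventually_dead j e -> i = j.
Proof.
  intros (n & Hn) (m & Hm).
  assert (H1 := Hn _ (sequence_reach n (n + m) ltac:(lia))).
  assert (H2 := Hm _ (sequence_reach m (n + m) ltac:(lia))).
  apply H2, H1.
Qed.

Lemma dead_spanned_finitary e i j : eventually_dead i e -> i <> j -> O j e -> ~ co j e ->
  c j (eventually_dead j) e.
Proof.
  intros (n & Hn) Hij Ho Hco.
  assert (Hd : dead O (s (S n)) e i) by (apply (dead_reach O (s n)); auto).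
  destruct (c_circ c co Hc j _ _ (Hsat n e i j Hd Hij Ho Hco)) as (C & HC & HCe & Hmin).
  { intro H. apply Hij. symmetry. apply (dead_committed _ _ _ _ Hd). apply H. }
  apply (c_mono c co Hc j C); auto.
  intros z Hz. exists (S n). destruct (sequence_invariant (S n)).
  apply (dead_of_committed_circuit O (s (S n)) C e i j); auto.
Qed.

(* Spans in a cofinitary matroid survive the passage to the limit, since their failure
   is witnessed by a finite cocircuit. *)
Lemma limit_span e j N : co j e ->
  (forall m, N <= m -> c j (fun z => z <> e /\ s m j z /\ co j z /\
    (committed E (s m) z j -> certified (s m) z j -> dead O (s m) z j)) e) ->
  c j (rem (eventually_dead j) e) e.
Proof.
  intros Hco Hm. apply NNPP; intro Hn.
  destruct (cs_cofin _ _ (Hc j) _ _ Hco Hn) as (L & HL & HL').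
  destruct (eventually_avoids L (fun m z => z <> e /\ s m j z /\ co j z /\
    (committed E (s m) z j -> certified (s m) z j -> dead O (s m) z j))) as (m0 & Hm0).
  (* From this stage on [x] is settled; if it still satisfied the condition it would be dead,
     whether certified or hopeless. *)
  - intros x Hx. exists (S (num x)). intros m Hle (Hxe & Hxs & Hxc & Hxd).
    apply (HL x Hx). split; [| exact Hxe]. exists m.
    assert (HEx : E x) by (apply (HOE j), (sequence_invariant m); auto).
    destruct (settled_reach O _ (s m) x (sequence_reach _ _ Hle) (Hsettled _ x HEx eq_refl))
      as [(i & Hi) Hset].
    rewrite <- (proj2 (proj2 Hi) j Hxs) in Hi.
    destruct (Hset j Hxc) as [H | H]; [auto | apply hopeless_dead; auto].
  - apply (HL' _ (Hm0 (N + m0) ltac:(lia))). apply Hm. lia.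
Qed.

Lemma hopeless_contradiction h j0 : committed E O h j0 -> co j0 h -> ~ hopeless O O h j0.
Proof.
  intros Hh Hco Hhop.
  assert (Hreach0 : forall m, reach O O (s m)).
  { intro m. eapply reach_trans; [exact Hs0 | apply sequence_reach; lia]. }
  assert (Hdead : dead O O h j0) by (apply hopeless_dead; auto).
  assert (HhD : eventually_dead j0 h).
  { exists 0. apply (dead_reach O O); auto. }
  assert (Hhs : c j0 (rem (eventually_dead j0) h) h).
  { apply (limit_span h j0 0); auto. intros m _.
    assert (Hcm : ~ certified (s m) h j0) by (apply Hhop; auto).
    assert (Hhm : s m j0 h) by (apply (Hdead (s m)); auto).
    apply spanned_by_undecided; auto.
    - apply NNPP; intro Hn; apply Hcm; intros _; exact Hn.
    - intros z Hz Hn.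
      destruct (classic (z = h)) as [-> | Hzh].
      + apply (dead_reach O O); auto.
      + exfalso; apply Hn, (c_ext c co Hc). split; auto. }
  assert (Hspan : forall i j e, eventually_dead i e -> O j e -> c j (eventually_dead j) e).
  { intros i j e He Ho. destruct (classic (i = j)) as [-> | Hij]; [apply (c_ext c co Hc); auto |].
    destruct (classic (co j e)) as [Hcoe | Hcoe]; [| eapply dead_spanned_finitary; eauto].
    destruct He as (n & Hn).
    apply (c_mono c co Hc j (rem (eventually_dead j) e)); [intros y [Hy _]; auto |].
    apply (limit_span e j n); auto. intros m Hm.
    assert (Hd : dead O (s m) e i) by (apply (dead_reach O (s n)); auto; apply sequence_reach; auto).
    apply spanned_by_undecided; auto.
    - apply (c_mono c co Hc j (s m j)).
      + intros y Hy; split; auto. intro H; unfold set1 in H; subst y.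
        apply Hij. symmetry. apply (dead_committed _ _ _ _ Hd); auto.
      + apply (dead_spanned_cofinitary O (s m) e i j); auto.
    - intros z Hz Hnz. apply (dead_of_cocircuit O (s m) e i j z); auto. }
  apply (HO (fun e => exists i, eventually_dead i e)
            (fun j e => eventually_dead j e /\ e <> h) h); [| eauto | intros i [_ H]; auto].
  split; [| split; [| split]].
  - intros e (i & n & Hn). apply (dead_committed _ _ _ _ Hn).
  - intros j e [He _]. split; [eauto |]. destruct He as (n & Hn).
    apply (sequence_invariant n), (dead_committed _ _ _ _ Hn).
  - intros i j e [Hi _] [Hj _]. eapply dead_class_unique; eauto.
  - intros j e (i & He) Ho. apply (c_trans c co Hc j (eventually_dead j)); [| eauto].
    intros y Hy. destruct (classic (y = h)) as [-> | Hyh]; [| apply (c_ext c co Hc); auto].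
    assert (j = j0) by (eapply dead_class_unique; eauto). subst j.
    apply (c_mono c co Hc j0 (rem (eventually_dead j0) h)); auto.
    intros w [Hw Hwh]; split; auto.
Qed.

End Limit.

Lemma certify O h j : exact E c O -> (forall i x, O i x -> E x) -> committed E O h j -> co j h ->
  exists P, exact E c P /\ refines E P O /\ certified P h j.
Proof.
  intros HO HOE Hh Hco.
  destruct (classic (hopeless O O h j)) as [Hhop | Hno].
  - exfalso.
    destruct (dependent_choice (fun P => reach O O P) (fun n P P' => reach O P P' /\
      (forall e, E e -> num e = n -> settled O P' e) /\ saturated O P') O (reach_refl O O))
      as (s & Hs0 & Hs).
    { intros n P HP.
      destruct (reach_invariant O O P HP) as [HPx HPO]; auto.
      assert (H1 : exists P1, reach O P P1 /\ forall e, E e -> num e = n -> settled O P1 e).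
      { destruct (classic (exists e, E e /\ num e = n)) as [(e & He & Hn) | Hno].
        - destruct (settle O P e HPx HPO He) as (P1 & Hr & Hset). exists P1. split; auto.
          intros e' He' Hn'. replace e' with e; auto. apply Hnum; congruence.
        - exists P. split; [apply reach_refl |]. intros e He Hn. exfalso; eauto. }
      destruct H1 as (P1 & Hr1 & Hset1).
      assert (HrP1 : reach O O P1) by (eapply reach_trans; eauto).
      destruct (saturate O P1) as (P2 & Hr2 & Hsat2).
      { apply (reach_invariant O O P1); auto. }
      exists P2. split; [eapply reach_trans; eauto |].
      split; [eapply reach_trans; eauto |]. split; auto.
      intros e He Hn. eapply settled_reach; eauto. }
    apply (hopeless_contradiction O HO HOE s) with (h := h) (j0 := j); auto.
    + rewrite Hs0. apply reach_refl.
    + intro n; apply Hs.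
    + intro n; apply Hs.
    + intro n; apply Hs.
  - assert (HP : exists P, reach O O P /\ certified P h j).
    { apply NNPP; intro H. apply Hno. intros P HP Hcert. apply H; eauto. }
    destruct HP as (P & HP & Hcert).
    destruct (reach_invariant O O P HP) as [HPx HPO]; auto.
    exists P. split; auto. split; auto. split; auto.
    (* Moves stay within [O], so an element already committed in [O] has nowhere else to go. *)
    intros x i (H1 & H2 & H3).
    destruct (exact_allowed P x HPx H1) as (k & Hk).
    split; [auto | split; [| auto]]. rewrite <- (H3 k); auto.
Qed.

Theorem exact_covering O : exact E c O -> (forall i x, O i x -> E x) ->
  exists I : Θ -> @set T, (forall x, E x <-> exists i, I i x) /\
    forall i e, I i e -> ~ c i (rem (I i) e) e.
Proof.
  intros HO HOE.
  destruct (dependent_choice (fun P => exact E c P /\ forall i x, P i x -> O i x)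
    (fun n P P' => refines E P' P /\
      forall e, E e -> num e = n -> exists i, committed E P' e i /\ (co i e -> certified P' e i)) O)
    as (s & Hs0 & Hs); [split; auto | |].
  { intros n P [HP HPO].
    destruct (classic (exists e, E e /\ num e = n)) as [(e & He & Hn) | Hno].
    - destruct (commit_element E c co Hc num Hnum P e HP He) as (P1 & HP1 & [Hr1 Hr1'] & i & Hi).
      assert (H2 : exists P2, exact E c P2 /\ refines E P2 P1 /\ (co i e -> certified P2 e i)).
      { destruct (classic (co i e)) as [Hco | Hco].
        - destruct (certify P1 e i) as (P2 & H1 & H2 & H3); auto.
          + intros k x Hx; eauto.
          + exists P2; auto.
        - exists P1. split; auto. split; [apply refines_refl | tauto]. }
      destruct H2 as (P2 & HP2 & [Hr2 Hr2'] & Hcert).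
      exists P2. split; [split; auto |]. split; [split; auto |].
      intros e' He' Hn'. assert (e' = e) by (apply Hnum; congruence). subst e'. exists i; auto.
    - exists P. split; [split; auto |]. split; [apply refines_refl |].
      intros e He Hn; exfalso; eauto. }
  assert (Hle : forall n m, n <= m -> refines E (s m) (s n)).
  { intros n m H; induction H as [| m H [IH1 IH2]]; [apply refines_refl |].
    destruct (Hs m) as (_ & [H1 H2] & _). split; auto. }
  set (I := fun i x => exists n, committed E (s n) x i).
  assert (HI : forall i x n, I i x -> s n i x).
  { intros i x n (m & Hm). apply (Hle n (n + m)); [lia |].
    apply (Hle m (n + m)) in Hm; [| lia]. apply Hm. }
  exists I. split.
  - intro x. split; [intro Hx | intros (i & n & Hx & _); auto].
    destruct (proj2 (proj2 (Hs (num x))) x Hx eq_refl) as (i & Hi & _). exists i, (S (num x)). auto.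
  - intros i e He Hcl.
    assert (HEe : E e) by (destruct He as (n & H & _); auto).
    destruct (proj2 (proj2 (Hs (num e))) e HEe eq_refl) as (k & Hk & Hcert).
    assert (k = i) by (symmetry; apply Hk; auto). subst k.
    destruct (classic (co i e)) as [Hco | Hco].
    + apply (Hcert Hco); [apply Hk |]. apply (c_mono c co Hc i (rem (I i) e)); auto.
      intros y [Hy Hye]; split; auto.
    + destruct (cs_fin _ _ (Hc i) _ _ Hco Hcl) as (C & (L & HL) & HCI & HCe).
      destruct (eventually_avoids L (fun m z => C z /\ ~ committed E (s m) z i)) as (m & Hm).
      { intros z _. destruct (classic (C z)) as [Hz | Hz].
        - destruct (HCI z Hz) as [(n & Hn) _]. exists n. intros m Hnm [_ H]. apply H.
          apply (Hle n m); auto.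
        - exists 0. tauto. }
      assert (HCm : forall z, C z -> committed E (s (m + S (num e))) z i).
      { intros z Hz. apply NNPP; intro H. apply (Hm (m + S (num e)) ltac:(lia) z); auto. }
      assert (Hem : committed E (s (m + S (num e))) e i) by (apply (Hle (S (num e))); [lia | auto]).
      apply (proj1 (proj1 (Hs (m + S (num e)))) (add C e) (fun k z => k = i /\ C z) e).
      * split; [| split; [| split]].
        -- intros x [Hx | Hx]; [apply (HCm x Hx) | unfold set1 in Hx; subst; auto].
        -- intros k x [-> Hx]. split; [left; auto | apply (HCm x Hx)].
        -- intros k k' x [-> _] [-> _]; auto.
        -- intros k x [Hx | Hx] Ho.
           ++ assert (k = i) by (apply (HCm x Hx); auto). subst k.
              apply (c_ext c co Hc). auto.
           ++ unfold set1 in Hx; subst x. assert (k = i) by (apply Hem; auto). subst k.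
              apply (c_mono c co Hc i C); auto.
              intros z Hz; split; auto.
      * right; reflexivity.
      * intros k [_ H]. destruct (HCI e H) as [_ H']; apply H'; reflexivity.
Qed.

End Certification.
(** * Restriction and contraction *)

Lemma spanning_restr {T : Type} (M : @matroid T) (HM : is_matroid M) (X S : @set T) :
  subset X (ground M) -> subset S X -> subset X (cl M S) -> spanning (restr M X) S.
Proof.
  intros HXg HSX Hspan e. split.
  - intros [He | (C & (HC & _) & HCe & _)]; [split; auto | apply HC; auto].
  - intros [He Hg]. destruct (Hspan e He) as [HeS | (I & HI & HIS & Hd)]; [left; auto |].
    destruct (classic (S e)) as [HeS | HeS]; [left; auto | right].
    exists (add (fund M I e) e). split; [| split].
    + apply circuit_restr; [apply fund_circuit; auto |].
      intros y [[Hy _] | Hy]; [auto | unfold set1 in Hy; subst; auto].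
    + right; reflexivity.
    + intros y [[Hy _] | Hy] Hye; [auto | contradiction].
Qed.

(** A maximal independent subset of [W] together with [I] extends to a base [B] of [M]; the
    complement of [B] in [X] is a base of the restricted dual and misses [I]. *)
Lemma indep_contr_to {T : Type} (M : @matroid T) (HM : is_matroid M) (W X I : @set T) :
  (forall x, ground M x <-> W x \/ X x) -> (forall x, ~ (W x /\ X x)) ->
  subset I X -> (forall e, I e -> ~ cl M (setU (rem I e) W) e) -> indep (contr_to M X) I.
Proof.
  intros HWX Hdisj HIX Hind.
  destruct (maximal_exists M HM W) as (BW & HBW).
  destruct (extend_maximal M HM (setU I BW) BW) as (K & HK & HBK);
    [apply HBW | intros y Hy; right; auto |].
  assert (HIK : subset I K).
  { intros e He. apply NNPP; intro Hn. apply (Hind e He).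
    apply (cl_mono M K).
    - intros y Hy. destruct (proj1 (proj2 HK) y Hy) as [H | H].
      + left; split; auto. intro H'; unfold set1 in H'; subst; auto.
      + right. apply HBW; auto.
    - apply (cl_maximal M HM (setU I BW)); auto. left; left; auto. }
  destruct (extend_maximal M HM (ground M) K) as (B & HB & HKB);
    [apply HK | exact (indep_ground M HM K (proj1 HK)) |].
  assert (HBi : indep M B) by apply HB.
  set (G := setD (ground M) (setD (ground M) X)).
  assert (HGX : forall x, G x <-> X x).
  { intro x. unfold G, setD. specialize (HWX x). tauto. }
  exists (setD G B). split.
  - split; [| split].
    + split; [| intros x [Hx _]; auto].
      exists B. split; auto. intros x [[Hx _] HxB]; split; auto.
    + intros x [Hx _]; split; auto. apply Hx.
    (* Some base [B2] avoids [D]. If [k] were in [B], then [B2], and with it [k], would be spanned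
       by [B] minus [k]. *)
    + intros D [(B2 & HB2 & HD) HDG] _ HBD k Hk. split; [exact (HDG k Hk) |].
      intro HkB.
      assert (HkX : X k) by exact (proj1 (HGX k) (HDG k Hk)).
      apply (cl_indep M HM (rem B k) k).
      * apply (cl_trans M HM B2).
        -- intros y Hy. destruct (classic (X y)) as [HyX | HyX].
           ++ apply cl_ext. split.
              ** apply NNPP; intro Hn. destruct (HD y) as [_ H]; auto.
                 apply HBD. split; auto. apply HGX; auto.
              ** intro H; unfold set1 in H; subst y. destruct (HD k) as [_ H]; auto.
           ++ apply (cl_mono M BW).
              ** intros w Hw. split; [auto |]. intro H; unfold set1 in H; subst w.
                 apply (Hdisj k). split; auto. apply HBW; auto.
              ** apply (cl_maximal M HM W); auto. left.
                 destruct (proj1 (HWX y)); [exact (indep_ground M HM B2 (proj1 HB2) y Hy) | auto | tauto].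
        -- apply (cl_maximal M HM (ground M)); auto. left; apply HWX; auto.
      * intros [_ H]; apply H; reflexivity.
      * apply (indep_sub M HM B); auto. intros y [[Hy _] | Hy]; [auto | unfold set1 in Hy; subst; auto].
  - intros x Hx. split.
    + split; [apply HGX; auto | apply HWX; auto].
    + intros [_ H]; auto.
Qed.

Theorem mainTheorem1 (T : Type) (E : @set T) (Θ : Type)
  (M : Θ -> (@set T -> Prop)) :
  countable_set E ->
  (forall i, is_matroid (Matroid E (M i))) ->
  (forall i, in_F_plus_Fstar (Matroid E (M i))) ->
  exists Ep Ec : @set T,
    (forall x, E x <-> Ep x \/ Ec x) /\ (forall x, ~ (Ep x /\ Ec x)) /\
    has_packing (fun i => restr (Matroid E (M i)) Ep) Ep /\
    has_covering (fun i => contr_to (Matroid E (M i)) Ec) Ec.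
Proof.
  intros (num & Hnum) HM HF.
  set (K := fun i => Matroid E (M i)).
  assert (Hco : exists co : Θ -> set, forall W i,
    closure_system (fun X => cl (K i) (setU X W)) (co i)).
  { destruct (functional_choice (fun i B => forall W,
      closure_system (fun X => cl (K i) (setU X W)) B)) as (co & Hco); [| exists co; auto].
    intro i. destruct (HF i) as (A & B & HAB & Hdisj & Hsum & HA & HB).
    exists B. intro W. apply (matroid_closure_system (K i) (HM i) A B); auto. }
  destruct Hco as (co & Hco).
  destruct (largest_pack E _ co (Hco set0) num Hnum (fun _ => E)) as (W & S & HW & Hmax).
  assert (HWE : subset W E) by apply HW.
  assert (HWS : forall i, subset W (cl (K i) (S i))).
  { intros i x Hx. apply (cl_mono (K i) (setU (S i) set0)); [intros y [Hy | []]; auto |].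
    apply HW; auto. }
  (* A packing of [X] in the contractions by [W] combines with [S] to a packing of [W] and [X]
     together, so maximality of [W] leaves only the empty [X]. *)
  assert (Hexact : exact (setD E W) (fun i X => cl (K i) (setU X W)) (fun _ => setD E W)).
  { intros X B x (B1 & B2 & B3 & B4) Hx _.
    apply (proj2 (B1 x Hx)).
    refine (Hmax (setU W X) (fun i => setU (S i) (B i)) _ x (or_intror Hx)).
    destruct HW as (_ & S2 & S3 & _). split; [| split; [| split]].
    + intros y [Hy | Hy]; [auto | apply B1; auto].
    + intros i y [Hy | Hy].
      * destruct (S2 i y Hy); split; [left |]; auto.
      * destruct (B2 i y Hy) as [HyX [HyE _]]; split; [right |]; auto.
    + intros i j y [Hy | Hy] [Hy' | Hy']; eauto.
      * exfalso. destruct (B2 j y Hy') as [_ [_ H]]. apply H, (S2 i y Hy).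
      * exfalso. destruct (B2 i y Hy) as [_ [_ H]]. apply H, (S2 j y Hy').
    + intros i y [Hy | Hy] HyE.
      * apply (cl_mono (K i) (S i)); [intros w Hw; left; left; auto |]. apply HWS; auto.
      * apply (cl_trans (K i) (HM i) (setU (B i) W)); [| apply B4; auto].
        intros w [Hw | Hw]; [left; left; right; auto |].
        apply (cl_mono (K i) (S i)); [intros v Hv; left; left; auto |]. apply HWS; auto. }
  destruct (exact_covering (setD E W) _ co (Hco W) num
    (fun x y Hx Hy => Hnum x y (proj1 Hx) (proj1 Hy)) _ Hexact (fun _ _ H => H))
    as (I & HI & Hind).
  exists W, (setD E W).
  assert (Hpart : forall x, E x <-> W x \/ setD E W x).
  { intro x. unfold setD. specialize (HWE x). destruct (classic (W x)); tauto. }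
  assert (Hdisj : forall x, ~ (W x /\ setD E W x)) by (intros x [H1 [_ H2]]; auto).
  split; [exact Hpart |]. split; [exact Hdisj |]. split.
  - exists S. destruct HW as (_ & S2 & S3 & _). split; [| split].
    * intros i x Hx. apply (S2 i x Hx).
    * intros i j x Hij Hx Hx'. apply Hij; eauto.
    * intro i. apply (spanning_restr (K i) (HM i)); auto.
      intros x Hx. apply (S2 i x Hx).
  - exists I. split; [| exact HI].
    intro i. apply (indep_contr_to (K i) (HM i) W); auto.
    intros x Hx. apply HI; eauto.
Qed.
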